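(* Let $(\mathcal X,\mathfrak S)$ be an HHS. For any $K_2\ge K_1\ge50E$ there exists $P_1=P_1(K_1,K_2)>0$ so that for any $x,y\in\mathcal X\cup\mathcal X^{ray}$, if $\mathcal V\subset\mathrm{Rel}_{K_1}(x,y)$ has $\#\mathcal V>P_1$, then there exist $W\in\mathrm{Rel}_{K_2}(x,y)$ and $\mathcal V'\subset\mathcal V$ so that $V\sqsubsetneq W$ for all $V\in\mathcal V'$ and $$\mathrm{diam}_W\Big(\bigcup_{V\in\mathcal V'}\rho^V_W\Big)>K_2.$$ Moreover, for any $\sigma\ge10E$ and $n\in\mathbb N$ there exists $P_2(K_1,K_2,\sigma,n)>0$ so that if $\#\mathcal V>P_2$, then $W\in\mathrm{Rel}_{K_2}(x,y)$ and $\mathcal V'\subset\mathcal V$ with $V\sqsubsetneq W$ for all $V\in\mathcal V'$ and $\mathrm{diam}_W\big(\bigcup_{V\in\mathcal V'}\rho^V_W\big)>K_2$ can be chosen so that, in addition, the following holds: if $\gamma$ is any geodesic in $\mathcal C(W)$ between $x,y$ and $\{x_i\}$ is a $\sigma$-subdivision of $\gamma$ determining sets $\mathcal V_i$, then $\#\{i:\mathcal V_i\ne\emptyset\}\ge n$.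
   Context: **Hierarchically hyperbolic spaces.** An HHS $(\mathcal X,\mathfrak S)$ is a $q$-quasigeodesic metric space $(\mathcal X,d_{\mathcal X})$ with a set $\mathfrak S$ of *domains*, a $\delta$-hyperbolic space $(\mathcal C(W),d_W)$ for each $W\in\mathfrak S$, and constants such that: (1) *Projections*: there are maps $\pi_W:\mathcal X\to 2^{\mathcal C(W)}$, uniformly coarsely Lipschitz, sending points to nonempty sets of diameter $\le\xi$, with $\pi_W(\mathcal X)$ uniformly quasiconvex. (2) *Nesting*: a partial order $\sqsubseteq$ on $\mathfrak S$ with a unique maximal element; for $V\sqsubsetneq W$ a set $\rho^V_W\subset\mathcal C(W)$ of diameter $\le\xi$ and a map $\rho^W_V:\mathcal C(W)\to2^{\mathcal C(V)}$; $\mathfrak S_W=\{V:V\sqsubseteq W\}$. (3) *Orthogonality*: a symmetric antireflexive relation $\perp$; $V\sqsubseteq W\perp U$ implies $V\perp U$; for $T\in\mathfrak S$ and $U\in\mathfrak S_T$ with $\{V\in\mathfrak S_T:V\perp U\}\ne\emptyset$ there is $W\in\mathfrak S_T-\{T\}$ such that $V\sqsubseteq W$ whenever $V\perp U$, $V\sqsubseteq T$; orthogonal domains are not $\sqsubseteq$-comparable. (4) *Transversality and consistency*: $V\pitchfork W$ means $V,W$ are neither orthogonal nor comparable; then there are sets $\rho^V_W\subset\mathcal C(W)$, $\rho^W_V\subset\mathcal C(V)$ of diameter $\le\xi$ with $\min\{d_W(\pi_W(x),\rho^V_W),d_V(\pi_V(x),\rho^W_V)\}\le\kappa_0$ for all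 $x$; if $V\sqsubsetneq W$ then $\min\{d_W(\pi_W(x),\rho^V_W),\mathrm{diam}(\pi_V(x)\cup\rho^W_V(\pi_W(x)))\}\le\kappa_0$; if $U\sqsubseteq V$ then $d_W(\rho^U_W,\rho^V_W)\le\kappa_0$ whenever $V\sqsubsetneq W$, or $V\pitchfork W$ and $W\not\perp U$. (5) *Finite complexity*: $\sqsubseteq$-chains have length at most some $n$. (6) *Large links*: there are $\lambda\ge1$, $E\ge\max\{\xi,\kappa_0\}$ so that for $W\in\mathfrak S$, $x,x'\in\mathcal X$ and $N=\lambda d_W(\pi_W(x),\pi_W(x'))+\lambda$ there are $T_1,\dots,T_{\lfloor N\rfloor}\in\mathfrak S_W-\{W\}$ such that each $T\in\mathfrak S_W-\{W\}$ is nested in some $T_i$ or has $d_T(\pi_T(x),\pi_T(x'))<E$, and $d_W(\pi_W(x),\rho^{T_i}_W)\le N$. (7) *Bounded geodesic image*: for $V\sqsubsetneq W$ and a geodesic $\gamma\subset\mathcal C(W)$, either $\mathrm{diam}\,\rho^W_V(\gamma)\le E$ or $\gamma$ meets the $E$-neighborhood of $\rho^V_W$. (8) *Partial realization*: there is $\alpha$ so that for pairwise orthogonal $\{V_j\}$ and $p_j\in\pi_{V_j}(\mathcal X)$ there is $x\in\mathcal X$ with $d_{V_j}(x,p_j)\le\alpha$ for all $j$ and $d_V(x,\rho^{V_j}_V)\le\alpha$ whenever $V_j\sqsubsetneq V$ or $V\pitchfork V_j$. (9) *Uniqueness*: for each $\kappa$ there is $\theta_u(\kappa)$ such that $d_{\mathcal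 X}(x,y)\ge\theta_u$ implies $d_V(x,y)\ge\kappa$ for some $V$. Here $d_W(x,y)=\mathrm{diam}(\pi_W(x)\cup\pi_W(y))$. HHSes are assumed *normalized*: each $\pi_W$ is uniformly coarsely surjective. $E$ is fixed sufficiently large depending only on $(\mathcal X,\mathfrak S)$, dominating all structure constants above (including those for hierarchy rays below). The constants $P_1,P_2$ may also depend on $(\mathcal X,\mathfrak S)$. **Hierarchy rays.** When rays occur $\mathcal X$ is proper. An $L$-hierarchy ray is an $(L,L)$-quasigeodesic $h:[0,\infty)\to\mathcal X$ projecting to an unparametrized $(L,L)$-quasigeodesic in every $\mathcal C(U)$, where $L=L(\mathcal X)$ is fixed so that any two points are joined by a path (on a compact interval) with the same properties; $\mathcal X^{ray}$ is the set of these rays. $\mathrm{supp}(h)=\{U:\mathrm{diam}\,\pi_U(h([0,\infty)))=\infty\}$ (a pairwise orthogonal set). Projections: for $U\in\mathrm{supp}(h)$, $\pi_U(h)\in\partial\mathcal C(U)$ is the limit of $\pi_U(h(t))$. For $U\notin\mathrm{supp}(h)$: if $U\sqsubsetneq V$ for some (unique) $V\in\mathrm{supp}(h)$, $\pi_U(h)=\rho^V_U(Y)$, $Y$ the set of points at distance at least $E+N$ from $\rho^U_V$ on $(1,20\delta)$-quasigeodesic rays from $\rho^U_V$ to $\pi_V(h)$ ($N$ the Morse constant for $(1,20\delta)$-quasigeodesics); if $U\perp V$ for all $V\in\mathrm{supp}(h)$, $\pi_U(h)=\pi_U(h(t_U))$ with $t_U$ such that $d_U(h(0),h(t_U))+1\ge\mathrm{diam}\,\pi_U(h)$;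 otherwise $\pi_U(h)=\bigcup\rho^V_U$ over $V\in\mathrm{supp}(h)$ with $V\pitchfork U$ or $V\sqsubsetneq U$. For $x,y\in\mathcal X\cup\mathcal X^{ray}$, $d_U(x,y)=\mathrm{diam}(\pi_U(x)\cup\pi_U(y))$, which is $\infty$ if exactly one projection is a boundary point or they are distinct boundary points (and $0$ if they are the same boundary point). $\mathrm{Rel}_K(x,y)=\{U\in\mathfrak S:d_U(x,y)\ge K\}$. **Subdivisions.** A path $\gamma:I\to\mathcal C(W)$ between $x,y$ joins $\pi_W(x)$ to $\pi_W(y)$ (a segment, ray or bi-infinite path). A $\sigma$-subdivision $\{x_i\}$ of $\gamma$ decomposes $I$ into intervals $[x_i,x_{i+1}]$, all of length exactly $\sigma$ except for at most one, of length less than $\sigma$. With $p_\gamma:\mathcal C(W)\to\gamma$ closest point projection, $\mathcal V_i=\{V\in\mathcal V':p_\gamma(\rho^V_W)\cap[x_i,x_{i+1}]\ne\emptyset\}$. *)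

(* Defs.v *)
From HB Require Import structures.
From mathcomp Require Import all_boot all_order all_algebra.
From mathcomp Require Import all_classical all_reals all_analysis.

Set Implicit Arguments.
Unset Strict Implicit.
Unset Printing Implicit Defensive.

Import Order.TTheory GRing.Theory Num.Theory.

Local Open Scope classical_set_scope.
Local Open Scope ring_scope.

(* * Metric and hyperbolic geometry *)

Section Metric.
Context {R : realType} {M : metricType R}.
Implicit Types (A B I : set R) (S T : set M) (f : R -> M) (F : R -> set M).

(* The [0 |`] only matters for S = set0, whose diameter is 0. *)
Definition diam S : \bar R :=
  ereal_sup (0%E |` [set (mdist z.1 z.2)%:E | z in S `*` S]).

(* Infimal distance; +oo if one of the sets is empty. *)
Definition setdist S T : \bar R :=
  ereal_inf [set (mdist z.1 z.2)%:E | z in S `*` T].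

Definition nbhd_of (r : R) S : set M :=
  [set z | (setdist [set z] S <= r%:E)%E].

Definition proper_space : Prop :=
  forall (x : M) (r : R), compact [set y | mdist x y <= r].

(* [f] restricted to [I] is a (k, c)-quasigeodesic; continuity is not
   required. *)
Definition quasigeodesic (k c : R) I f : Prop :=
  forall s t, I s -> I t ->
    k^-1 * `|s - t| - c <= mdist (f s) (f t) <= k * `|s - t| + c.

Definition geodesic I f : Prop :=
  forall s t, I s -> I t -> mdist (f s) (f t) = `|s - t|.

Definition geodesic_segment (l : R) f (x y : M) : Prop :=
  [/\ 0 <= l, geodesic `[0, l] f, f 0 = x & f l = y].

(* A coarse path F is an unparametrized (L, L)-quasigeodesic on I when it
   factors through a monotone reparametrization of I onto an interval along
   which it is an (L, L)-quasigeodesic; this covers both bounded and unbounded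
   images of a half-line. *)
Definition unparam_quasigeodesic (L : R) I F : Prop :=
  exists phi : R -> R,
    [/\ forall s t, I s -> I t -> s <= t -> phi s <= phi t,
        is_interval (phi @` I)
      & forall s t, I s -> I t ->
          ((L^-1 * `|phi s - phi t| - L)%:E <= diam (F s `|` F t)
             <= (L * `|phi s - phi t| + L)%:E)%E].

Definition quasiconvex (k : R) S : Prop :=
  forall (l : R) f x y, S x -> S y -> geodesic_segment l f x y ->
    f @` `[0, l] `<=` nbhd_of k S.

Definition geodesic_space : Prop :=
  forall x y : M, exists l f, geodesic_segment l f x y.

Definition slim_triangles (delta : R) : Prop :=
  forall (x y z : M) l1 l2 l3 f1 f2 f3,
    geodesic_segment l1 f1 x y -> geodesic_segment l2 f2 y z ->
    geodesic_segment l3 f3 x z ->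
    f1 @` `[0, l1] `<=` nbhd_of delta (f2 @` `[0, l2] `|` f3 @` `[0, l3]).

Definition hyperbolic (delta : R) : Prop :=
  [/\ 0 <= delta, geodesic_space & slim_triangles delta].

Definition gromov_product (p x y : M) : R :=
  (mdist x p + mdist y p - mdist x y) / 2.

Definition asymptotic (u v : nat -> M) : Prop :=
  forall (p : M) (r : R), exists k : nat, forall i j : nat,
    (k <= i)%N -> (k <= j)%N -> r <= gromov_product p (u i) (v j).

Definition converges_at_infinity (u : nat -> M) : Prop := asymptotic u u.

(* The sequential Gromov boundary: a boundary point is the equivalence class
   of a sequence converging at infinity. *)
Definition gromov_boundary : set (set (nat -> M)) :=
  [set b | exists2 u, converges_at_infinity u &
             b = [set v | converges_at_infinity v /\ asymptotic u v]].

(* F t converges to the boundary point b as t tends to +oo. *)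
Definition tends_to F (b : set (nat -> M)) : Prop :=
  gromov_boundary b /\
  forall (t : nat -> R) (u : nat -> M),
    t @ \oo --> +oo -> (forall n, F (t n) (u n)) -> b u.

Definition boundary_limit F : set (nat -> M) := xget set0 (tends_to F).

(* N is a Morse constant for (k, c)-quasigeodesics: such a segment is at
   Hausdorff distance at most N from any geodesic with the same endpoints. *)
Definition morse_constant (k c N : R) : Prop :=
  0 <= N /\
  forall (m l : R) f g x y,
    0 <= m -> quasigeodesic k c `[0, m] f -> f 0 = x -> f m = y ->
    geodesic_segment l g x y ->
    f @` `[0, m] `<=` nbhd_of N (g @` `[0, l]) /\
    g @` `[0, l] `<=` nbhd_of N (f @` `[0, m]).

End Metric.

Arguments proper_space {R} M.
Arguments hyperbolic {R} M.
Arguments gromov_boundary {R} M.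
Arguments morse_constant {R} M.

(* A value of an extended projection: a subset of M or a boundary point. *)
Inductive endpoint (R : realType) (M : metricType R) :=
  | Inside of set M
  | AtInfinity of set (nat -> M).
Arguments Inside {R M}.
Arguments AtInfinity {R M}.

Section Endpoints.
Context {R : realType} {M : metricType R}.

Definition endpoint_dist (c c' : endpoint M) : \bar R :=
  match c, c' with
  | Inside A, Inside B => diam (A `|` B)
  | AtInfinity b, AtInfinity b' => if `[< b = b' >] then 0%E else +oo%E
  | _, _ => +oo%E
  end.

Definition domain (a b : \bar R) : set R :=
  [set t | (a <= t%:E)%E /\ (t%:E <= b)%E].

Definition starts_at (g : R -> M) (a : \bar R) (c : endpoint M) : Prop :=
  match a, c with
  | r%:E%E, Inside A => A (g r)
  | -oo%E, AtInfinity p => tends_to (fun t => [set g (- t)]) p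
  | _, _ => False
  end.

Definition stops_at (g : R -> M) (b : \bar R) (c : endpoint M) : Prop :=
  match b, c with
  | r%:E%E, Inside A => A (g r)
  | +oo%E, AtInfinity p => tends_to (fun t => [set g t]) p
  | _, _ => False
  end.

(* A geodesic segment, ray or line, defined on the real points of [a, b],
   joining c to c'. *)
Definition geodesic_between (a b : \bar R) (g : R -> M) (c c' : endpoint M) :
    Prop :=
  [/\ (a <= b)%E, geodesic (domain a b) g, starts_at g a c & stops_at g b c'].

(* A choice of closest points on g, recorded by their parameters in I. *)
Definition closest_point_projection (I : set R) (g : R -> M) (p : M -> R) :
    Prop :=
  forall z, I (p z) /\ forall t, I t -> mdist z (g (p z)) <= mdist z (g t).

End Endpoints.

(* J indexes the pieces [x i, x (i + 1)], i in J, of I. As J is an interval of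
   integers the pieces are consecutive. *)
Definition subdivision (R : realType) (sigma : R) (I : set R) (J : set int)
    (x : int -> R) : Prop :=
  [/\ forall i j k : int, J i -> J k -> i <= j <= k -> J j,
      I = \bigcup_(i in J) `[x i, x (i + 1)]%classic,
      forall i, J i -> x i <= x (i + 1) <= x i + sigma
    & forall i j, J i -> J j ->
        x (i + 1) < x i + sigma -> x (j + 1) < x j + sigma -> i = j].

(* * Hierarchically hyperbolic spaces *)

Section HHS.
Context {R : realType} {d : Order.disp_t}.

(* The order of Dom is the nesting relation. [rho V W] is the subset
   $\rho^V_W$ of C(W), used for V < W and for transverse V, W; [rhomap W V] is
   the map $\rho^W_V$ from C(W) to subsets of C(V), used for V < W. Their
   other values are irrelevant. *)
Record hhs_data (X : metricType R) (Dom : porderType d) := HhsData {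
  C : Dom -> metricType R;
  proj : forall W, X -> set (C W);
  orth : Dom -> Dom -> Prop;
  rho : forall V W : Dom, set (C W);
  rhomap : forall W V : Dom, C W -> set (C V)
}.
Arguments C {X Dom}.
Arguments proj {X Dom}.
Arguments orth {X Dom}.
Arguments rho {X Dom}.
Arguments rhomap {X Dom} h {W} V.

Record hhs_constants := HhsConstants {
  c_q : R;              (* quasigeodesic space *)
  c_delta : R;          (* hyperbolicity *)
  c_xi : R;             (* diameters of projections *)
  c_K : R;              (* coarse Lipschitz, quasiconvex, coarsely onto *)
  c_kappa0 : R;         (* consistency *)
  c_n : nat;            (* complexity *)
  c_lambda : R;         (* large links *)
  c_E : R;              (* large links, bounded geodesic image *)
  c_alpha : R;          (* partial realization *)
  c_theta : R -> R      (* uniqueness *)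
}.

Context {X : metricType R} {Dom : porderType d}.
Implicit Types (H : hhs_data X Dom) (c : hhs_constants).
Implicit Types (T U V W : Dom) (x y : X).

Definition proj_image H W : set (C H W) := \bigcup_x proj H W x.
Arguments proj_image : clear implicits.

Definition transverse H V W : Prop := ~ orth H V W /\ (V >< W)%O.

Definition pdist H W x y : \bar R := diam (proj H W x `|` proj H W y).

Definition hhs_ambient c : Prop :=
  1 <= c_q c /\
  forall x y, exists (l : R) (f : R -> X),
    [/\ 0 <= l, f 0 = x, f l = y
      & quasigeodesic (c_q c) (c_q c) `[0, l] f].

Definition hhs_hyperbolic H c : Prop :=
  forall W, hyperbolic (C H W) (c_delta c).

Definition hhs_projections H c : Prop :=
  [/\ forall W x, proj H W x !=set0,
      forall W x, (diam (proj H W x) <= (c_xi c)%:E)%E,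
      forall W x y, (pdist H W x y <= (c_K c * mdist x y + c_K c)%:E)%E
    & forall W, quasiconvex (c_K c) (proj_image H W)].

(* Maps into $2^{C(V)}$ are coarse maps: their values are nonempty. *)
Definition hhs_nesting H c : Prop :=
  [/\ exists! M : Dom, forall V, (M <= V)%O -> V = M,
      forall V W, (V < W)%O ->
        rho H V W !=set0 /\ (diam (rho H V W) <= (c_xi c)%:E)%E
    & forall V W, (V < W)%O -> forall p : C H W, rhomap H V p !=set0].

Definition hhs_orthogonality H : Prop :=
  [/\ forall V W, orth H V W -> orth H W V,
      forall V, ~ orth H V V,
      forall U V W, (V <= W)%O -> orth H W U -> orth H V U,
      forall T U, (U <= T)%O -> (exists2 V, (V <= T)%O & orth H V U) ->
        exists2 W, (W < T)%O &
          forall V, (V <= T)%O -> orth H V U -> (V <= W)%O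
    & forall V W, orth H V W -> (V >< W)%O].

Definition hhs_consistency H c : Prop :=
  [/\ forall V W, transverse H V W ->
        rho H V W !=set0 /\ (diam (rho H V W) <= (c_xi c)%:E)%E,
      forall V W x, transverse H V W ->
        (mine (setdist (proj H W x) (rho H V W))
              (setdist (proj H V x) (rho H W V)) <= (c_kappa0 c)%:E)%E,
      forall V W x, (V < W)%O ->
        (mine (setdist (proj H W x) (rho H V W))
              (diam (proj H V x `|`
                     \bigcup_(p in proj H W x) rhomap H V p))
           <= (c_kappa0 c)%:E)%E
    & forall U V W, (U <= V)%O ->
        (V < W)%O \/ (transverse H V W /\ ~ orth H W U) ->
        (setdist (rho H U W) (rho H V W) <= (c_kappa0 c)%:E)%E].

Definition hhs_finite_complexity c : Prop :=
  forall s : seq Dom, sorted <%O s -> (size s <= c_n c)%N.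

(* There are at most $\lfloor N\rfloor$ domains T_i (none if W is minimal). *)
Definition hhs_large_links H c : Prop :=
  [/\ 1 <= c_lambda c, c_xi c <= c_E c, c_kappa0 c <= c_E c
    & forall W x y,
        let N := ((c_lambda c)%:E * setdist (proj H W x) (proj H W y)
                  + (c_lambda c)%:E)%E in
        exists s : seq Dom,
          [/\ ((size s)%:R%:E <= N)%E,
              forall T, T \in s ->
                (T < W)%O /\ (setdist (proj H W x) (rho H T W) <= N)%E
            & forall T, (T < W)%O ->
                (exists2 T', T' \in s & (T <= T')%O) \/
                (setdist (proj H T x) (proj H T y) < (c_E c)%:E)%E]].

Definition hhs_bounded_geodesic_image H c : Prop :=
  forall V W (I : set R) (g : R -> C H W), (V < W)%O ->
    is_interval I -> geodesic I g ->
    (diam (\bigcup_(t in I) rhomap H V (g t)) <= (c_E c)%:E)%E \/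
    exists2 t, I t & nbhd_of (c_E c) (rho H V W) (g t).

Definition hhs_partial_realization H c : Prop :=
  forall (J : Type) (V : J -> Dom) (p : forall j, C H (V j)),
    (forall i j, i <> j -> orth H (V i) (V j)) ->
    (forall j, proj_image H (V j) (p j)) ->
    exists x,
      (forall j, (setdist (proj H (V j) x) [set p j] <= (c_alpha c)%:E)%E) /\
      forall j W, (V j < W)%O \/ transverse H W (V j) ->
        (setdist (proj H W x) (rho H (V j) W) <= (c_alpha c)%:E)%E.

Definition hhs_uniqueness H c : Prop :=
  forall (kappa : R) x y, c_theta c kappa <= mdist x y ->
    exists V, (kappa%:E <= pdist H V x y)%E.

Definition hhs_normalized H c : Prop :=
  forall W (p : C H W), nbhd_of (c_K c) (proj_image H W) p.

Record is_hhs H c : Prop := IsHhs {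
  hhs_ambientP : hhs_ambient c;
  hhs_hyperbolicP : hhs_hyperbolic H c;
  hhs_projectionsP : hhs_projections H c;
  hhs_nestingP : hhs_nesting H c;
  hhs_orthogonalityP : hhs_orthogonality H;
  hhs_consistencyP : hhs_consistency H c;
  hhs_finite_complexityP : hhs_finite_complexity c;
  hhs_large_linksP : hhs_large_links H c;
  hhs_bounded_geodesic_imageP : hhs_bounded_geodesic_image H c;
  hhs_partial_realizationP : hhs_partial_realization H c;
  hhs_uniquenessP : hhs_uniqueness H c;
  hhs_normalizedP : hhs_normalized H c
}.

(* * Hierarchy rays *)

Definition hierarchy_path H (L : R) (I : set R) (h : R -> X) : Prop :=
  quasigeodesic L L I h /\
  forall U, unparam_quasigeodesic L I (fun t => proj H U (h t)).

Definition hierarchy_constant H (L : R) : Prop :=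
  1 <= L /\
  forall x y, exists (l : R) (h : R -> X),
    [/\ 0 <= l, h 0 = x, h l = y & hierarchy_path H L `[0, l] h].

(* Only the restriction of h to [0, +oo[ is relevant. Rays are considered only
   when X is proper, so that otherwise there are none. *)
Definition Xray H (L : R) : set (R -> X) :=
  [set h | proper_space X /\ hierarchy_path H L `[0, +oo[ h].

Definition supp H (h : R -> X) : set Dom :=
  [set U | diam (\bigcup_(t in `[0, +oo[%classic) proj H U (h t)) = +oo%E].

(* [tau h U] is a choice of the time t_U, for U orthogonal to supp(h): the
   distance from the initial point is maximal up to 1. The comparison is with
   the distances from h 0 because a time t such that d_U(h 0, h t) + 1 bounds the
   diameter of the whole projection of h need not exist; when there is one, it
   is accepted here. *)
Definition time_choice H (L : R) (tau : (R -> X) -> Dom -> R) : Prop :=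
  forall h U, Xray H L h -> (forall V, supp H h V -> orth H U V) ->
    0 <= tau h U /\
    forall t : R, 0 <= t ->
      (pdist H U (h 0%R) (h t) <= pdist H U (h 0%R) (h (tau h U)) + 1)%E.

Definition ray_limit H (h : R -> X) U : set (nat -> C H U) :=
  boundary_limit (fun t => proj H U (h t)).
Arguments ray_limit : clear implicits.

(* The set Y of the definition of $\pi_U(h)$, for U < V and V in supp(h). *)
Definition far_points H c (E N : R) (h : R -> X) U V : set (C H V) :=
  [set z | exists (g : R -> C H V) (t : R),
     [/\ quasigeodesic 1 (20 * c_delta c) `[0, +oo[ g /\ rho H U V (g 0),
         tends_to (fun s => [set g s]) (ray_limit H h V),
         0 <= t, z = g t
       & ((E + N)%:E <= setdist [set z] (rho H U V))%E]].
Arguments far_points : clear implicits.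

(* In the second case the V in the union is unique, as supp(h) consists of
   pairwise orthogonal domains. *)
Definition ray_proj H c (E N : R) (tau : (R -> X) -> Dom -> R)
    (h : R -> X) U : endpoint (C H U) :=
  if `[< supp H h U >] then AtInfinity (ray_limit H h U)
  else if `[< exists2 V, supp H h V & (U < V)%O >] then
    Inside (\bigcup_(V in [set V | supp H h V /\ (U < V)%O])
              \bigcup_(z in far_points H c E N h U V) rhomap H U z)
  else if `[< forall V, supp H h V -> orth H U V >] then
    Inside (proj H U (h (tau h U)))
  else
    Inside (\bigcup_(V in [set V | supp H h V /\
                                   (transverse H V U \/ (V < U)%O)])
              rho H V U).

(* $X \cup X^{ray}$ *)
Definition in_ext H (L : R) (x : X + (R -> X)) : Prop :=
  match x with inl _ => True | inr h => Xray H L h end.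

Definition ext_proj H c E N tau (x : X + (R -> X)) U : endpoint (C H U) :=
  match x with
  | inl x => Inside (proj H U x)
  | inr h => ray_proj H c E N tau h U
  end.

Definition Rel H c E N tau (K : R) (x y : X + (R -> X)) : set Dom :=
  [set U | (K%:E <= endpoint_dist (ext_proj H c E N tau x U)
                                  (ext_proj H c E N tau y U))%E].

(* W and V' are as in the conclusion of passing up. *)
Definition passes_up H c E N tau (K2 : R) (x y : X + (R -> X))
    (Vs : set Dom) (W : Dom) (Vs' : set Dom) : Prop :=
  [/\ Rel H c E N tau K2 x y W, Vs' `<=` Vs,
      forall V, Vs' V -> (V < W)%O
    & (K2%:E < diam (\bigcup_(V in Vs') rho H V W))%E].

(* The set V_i attached to the piece [x i, x (i + 1)] of a subdivision. *)
Definition piece_domains H W (Vs' : set Dom) (p : C H W -> R) (x : int -> R)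
    (i : int) : set Dom :=
  [set V | Vs' V /\ p @` rho H V W `&` `[x i, x (i + 1)]%classic !=set0].

End HHS.

Arguments hhs_constants R : clear implicits.
Arguments C {R d X Dom}.
Arguments proj {R d X Dom}.
Arguments orth {R d X Dom}.
Arguments rho {R d X Dom}.
Arguments rhomap {R d X Dom} h {W} V.
Arguments proj_image {R d X Dom}.
Arguments ray_limit {R d X Dom}.
Arguments far_points {R d X Dom}.
Arguments piece_domains {R d X Dom} H {W}.

(* Main.v *)
From mathcomp Require Import all_boot all_order all_algebra.
From mathcomp Require Import all_classical all_reals all_analysis.
From mathcomp Require Import ring lra zify.
Require Import Defs.

(** A ray [h] is replaced by the points [h t], [t] large: off the support of [h]
the projection of [h] is at bounded distance from those of [h t], and on the
support these converge to the boundary point. This reduces the choice of [W] to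
the case of two points [x], [y] of [X].

For two points, let many relevant domains be nested in [W]. Either enough of
their sets [rho V W] are far from each other, and [W] is as wanted; or many of
them are close to one point [m] of [C W]. In that case, moving [x] and [y]
towards [m] changes nothing in these domains by bounded geodesic image, and
large links for the new points, whose projections to [W] are at bounded
distance, puts many of these domains below a single [T < W]. By finite
complexity the second case cannot repeat.

By bounded geodesic image, [rho V W] is close to any geodesic of [C W] joining
[x] to [y] when [V] is relevant. Hence two sets [rho V W] at distance [D] force
the distance in [W] between [x] and [y] to be almost [D], and sets which are
far from each other project to different pieces of a subdivision. *)

(** No geodesic joins points that run off to infinity, so the closeness of [rho V W] to geodesics is
    expressed by an upper bound on the Gromov product of the end points, based at [rho V W]. By the
    four-point inequality such a bound survives, up to a constant, when an end point is replaced by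
    another one converging to the same boundary point, and it can be turned back into closeness to a
    geodesic segment, ray or line.

    The time from which [h t] is a good substitute for [h] depends on the domain. Hence a finite
    list of domains is cut out of the given set before a common time [T] is chosen; the domains of
    the list then stay relevant for all [t >= T], which lets [t] tend to infinity in the chosen [W].

    Paths need not be continuous, so the Morse property is obtained from discrete samples: a dyadic
    use of the four-point inequality along [n] samples costs only the logarithm of [n], against a
    linear divergence. *)

Set Implicit Arguments.
Unset Strict Implicit.
Unset Printing Implicit Defensive.

Import Order.TTheory GRing.Theory Num.Theory.
Local Open Scope classical_set_scope.
Local Open Scope ring_scope.

(** * Hyperbolic spaces *)

Section Metric.
Context {R : realType} {M : metricType R}.
Implicit Types (S T : set M) (p q x y z : M) (r e : R).
Local Notation gp := (@gromov_product R M).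

Lemma diam_ub S r x y : (diam S <= r%:E)%E -> S x -> S y -> mdist x y <= r.
Proof.
move=> Sr Sx Sy; rewrite -lee_fin; apply: le_trans Sr.
by apply: ereal_sup_ubound; right; exists (x, y).
Qed.

Lemma diam_le S r : 0 <= r -> (forall x y, S x -> S y -> mdist x y <= r) ->
  (diam S <= r%:E)%E.
Proof.
move=> r0 Sr; apply: ge_ereal_sup => _ [->|[[x y] [/= Sx Sy] <-]].
  by rewrite lee_fin.
by rewrite lee_fin; apply: Sr.
Qed.

Lemma le_diam S r x y : S x -> S y -> r <= mdist x y -> (r%:E <= diam S)%E.
Proof.
move=> Sx Sy rxy; apply: (@le_trans _ _ (mdist x y)%:E); rewrite ?lee_fin//.
by apply: ereal_sup_ubound; right; exists (x, y).
Qed.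

Lemma lt_diam S r x y : S x -> S y -> r < mdist x y -> (r%:E < diam S)%E.
Proof.
move=> Sx Sy rxy; apply: (@lt_le_trans _ _ (mdist x y)%:E); rewrite ?lte_fin//.
exact: le_diam Sx Sy (lexx _).
Qed.

Lemma diam_gt S r : 0 <= r -> (r%:E < diam S)%E ->
  exists x y, [/\ S x, S y & r < mdist x y].
Proof.
move=> r0 rS; apply: contrapT => no; move: rS; rewrite ltNge => /negP; apply.
apply: diam_le => // x y Sx Sy; rewrite leNgt; apply/negP => lt.
by apply: no; exists x, y.
Qed.

Lemma setdist_le S T r x y : S x -> T y -> mdist x y <= r ->
  (setdist S T <= r%:E)%E.
Proof.
move=> Sx Ty xyr; apply: (@le_trans _ _ (mdist x y)%:E); rewrite ?lee_fin//.
by apply: ereal_inf_lbound; exists (x, y).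
Qed.

(** The infimum need not be attained, whence the strictly larger bound [r']; this is the origin of
    terms such as [delta + 1] below. *)
Lemma setdist_lt S T r r' : (setdist S T <= r%:E)%E -> r < r' ->
  exists x y, [/\ S x, T y & mdist x y < r'].
Proof.
move=> STr rr'.
have /ereal_inf_lt[_ [[x y] [/= Sx Ty] <-]] : (setdist S T < r'%:E)%E.
  by apply: le_lt_trans STr _; rewrite lte_fin.
by rewrite lte_fin => lt; exists x, y.
Qed.

Lemma gpC p x y : gp p x y = gp p y x.
Proof. by rewrite /gromov_product (metric_sym x y) [mdist x p + _]addrC. Qed.

Lemma gp_le_dist p x y : gp p x y <= mdist x p.
Proof.
have := metric_triangle y x p; rewrite (metric_sym y x) /gromov_product; lra.
Qed.

Lemma gpxx p x : gp p x x = mdist x p.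
Proof. by rewrite /gromov_product mdistxx subr0; field. Qed.

Lemma gp_sum p x y : gp p x y + gp x p y = mdist p x.
Proof. by rewrite /gromov_product (metric_sym x p) (metric_sym y p)
  (metric_sym y x); field. Qed.

Lemma gp_lip p x x' y : gp p x y <= gp p x' y + mdist x x'.
Proof.
have := metric_triangle x x' p; have := metric_triangle x' x y.
rewrite (metric_sym x' x) /gromov_product; lra.
Qed.

Lemma gp_lip2 p x y y' : gp p x y <= gp p x y' + mdist y y'.
Proof. by rewrite gpC (gpC p x); apply: gp_lip. Qed.

Lemma gp_lip0 p p' x y : gp p x y <= gp p' x y + mdist p p'.
Proof.
have := metric_triangle x p' p; have := metric_triangle y p' p.
rewrite (metric_sym p' p) /gromov_product; lra.
Qed.

(** [q] stands for a point of a geodesic from [x] to [y]. This half of the comparison between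
    products and distances to geodesics holds in every metric space. *)
Lemma gp_btw p q x y : mdist x q + mdist q y = mdist x y ->
  gp p x y <= mdist p q.
Proof.
have := metric_triangle x q p; have := metric_triangle y q p.
rewrite (metric_sym y q) (metric_sym q p) /gromov_product; lra.
Qed.

Lemma geodesic_split l f x y t : geodesic_segment l f x y -> 0 <= t <= l ->
  mdist x (f t) = t /\ mdist (f t) y = l - t.
Proof.
move=> [l0 geo <- <-] /andP[t0 tl].
rewrite !geo/= ?in_itv/= ?lexx ?l0 ?t0 ?tl// sub0r normrN ger0_norm//.
by rewrite distrC ger0_norm ?subr_ge0.
Qed.

Lemma geodesic_length l f x y : geodesic_segment l f x y -> mdist x y = l.
Proof.
move=> g; have [l0 _ _ fl] := g.
by have [] := geodesic_split g (t := l); rewrite ?l0 ?lexx// fl.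
Qed.

Lemma gp_geodesic p l f x y t : geodesic_segment l f x y -> 0 <= t <= l ->
  gp p x y <= mdist p (f t).
Proof.
move=> g tl; apply: gp_btw; have [-> ->] := geodesic_split g tl.
by rewrite (geodesic_length g); ring.
Qed.

(* That is, [gp p x z >= min (gp p x y) (gp p y z) - a]. *)
Definition four_point (a : R) : Prop :=
  forall p x y z r, r <= gp p x y -> r <= gp p y z -> r - a <= gp p x z.

(** Each point of [[x, y]] is close to [[x, p]] or to [[y, p]], and the side changes between [x] and
    [y]. Around the change a point is close to both sides, and the triangle inequalities for the two
    sides add up to the product. *)
Lemma slim_near_geodesic delta p l f x y : hyperbolic M delta ->
  geodesic_segment l f x y ->
  exists2 t, 0 <= t <= l & mdist p (f t) <= gp p x y + 2 * delta + 3.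
Proof.
move=> [d0 geo slim] gf; have [l0 f_geo f0 fl] := gf.
have [l2 [f2 g2]] := geo y p; have [l3 [f3 g3]] := geo x p.
have near t : 0 <= t <= l ->
    (exists2 s, 0 <= s <= l2 & mdist (f t) (f2 s) <= delta + 1) \/
    (exists2 s, 0 <= s <= l3 & mdist (f t) (f3 s) <= delta + 1).
  move=> tl.
  have : nbhd_of delta (f2 @` `[0, l2] `|` f3 @` `[0, l3]) (f t).
    by apply: (slim _ _ _ _ _ _ _ _ _ gf g2 g3); exists t; rewrite //= in_itv.
  move=> /(setdist_lt (r' := delta + 1))[|u [v [-> + uv]]]; first by lra.
  by move=> [[s]|[s]]; rewrite /= in_itv/= => sl sv; [left|right];
     exists s => //; rewrite sv ltW.
pose good t := exists2 s, 0 <= s <= l3 & mdist (f t) (f3 s) <= delta + 1.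
have [t [t' [tl tl' tt' [s sl ts] [s' sl' ts']]]] : exists t t',
    [/\ 0 <= t <= l, 0 <= t' <= l, `|t - t'| <= 1, good t &
        exists2 s, 0 <= s <= l2 & mdist (f t') (f2 s) <= delta + 1].
  (* Unit steps replace a connectedness argument: without a change of sides, closeness to [[x, p]]
     propagates from [x] to [y], but [y] lies on [[y, p]] as well. *)
  apply: contrapT => no.
  have all_good n : good (Num.min n%:R l).
    elim: n => [|n IHn].
      rewrite min_l//; have [l30 _ f30 _] := g3.
      exists 0; rewrite ?lexx// f0 f30 mdistxx; lra.
    have min_l m : 0 <= Num.min (m%:R : R) l <= l.
      by rewrite le_min ler0n l0 ge_min lexx orbT.
    have [ex2|//] := near _ (min_l n.+1).
    exfalso; apply: no; exists (Num.min n%:R l), (Num.min n.+1%:R l).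
    split=> //; rewrite -natr1; case: (lerP n%:R l); case: (lerP (n%:R + 1) l);
      rewrite ler_norml; lra.
  apply: no; exists l, l; rewrite l0 lexx subrr normr0; split=> //.
    have := all_good (Num.trunc l).+1; rewrite min_r//.
    exact/ltW/truncnS_gt.
  have [l20 _ f20 _] := g2.
  exists 0; rewrite ?lexx// f20 fl mdistxx; lra.
exists t => //.
have [e1 e2] := geodesic_split gf tl; have [e1' e2'] := geodesic_split gf tl'.
have [e3 e4] := geodesic_split g3 sl; have [e5 e6] := geodesic_split g2 sl'.
have e7 := geodesic_length g3; have e8 := geodesic_length g2.
have e9 := geodesic_length gf.
have t1 := metric_triangle x (f3 s) (f t).
have t2 := metric_triangle (f t) (f3 s) p.
have t3 := metric_triangle (f t') (f2 s') p.
have t4 := metric_triangle (f t') (f2 s') y.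
have t5 : mdist (f t) (f t') <= 1 by rewrite f_geo//= in_itv/=.
have t6 := metric_triangle (f t) (f t') p.
move: tt'; rewrite ler_norml => /andP[tt1 tt2].
rewrite (metric_sym (f3 s) (f t)) in t1.
rewrite (metric_sym (f2 s') y) in t4.
rewrite /gromov_product (metric_sym p (f t)); lra.
Qed.

(** A point of [[x, z]] almost realizes the product at [p], up to [2 * delta + 3], and is
    [(delta + 1)]-close to one of the other two sides, whose points are at distance at least [r]
    from [p]. *)
Lemma slim_four_point delta : hyperbolic M delta -> four_point (3 * delta + 4).
Proof.
move=> hyp p x y z r rxy ryz; have [d0 geo slim] := hyp.
have [l1 [f1 g1]] := geo x z.
have [l2 [f2 g2]] := geo z y; have [l3 [f3 g3]] := geo x y.
have [t tl pt] := slim_near_geodesic p hyp g1.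
have : nbhd_of delta (f2 @` `[0, l2] `|` f3 @` `[0, l3]) (f1 t).
  by apply: (slim _ _ _ _ _ _ _ _ _ g1 g2 g3); exists t; rewrite //= in_itv.
move=> /(setdist_lt (r' := delta + 1))[|u [v [-> vs tv]]]; first by lra.
have : r <= mdist p v.
  case: vs => [[s]|[s]]; rewrite /= in_itv/= => sl <-.
    by apply: le_trans ryz _; rewrite gpC; apply: gp_geodesic g2 sl.
  by apply: le_trans rxy _; apply: gp_geodesic g3 sl.
have := metric_triangle p (f1 t) v; lra.
Qed.

End Metric.
Arguments four_point {R} M.

(** * Stability of quasigeodesics *)

Lemma linear_le_expn (R : realType) (c1 c2 : R) :
  exists k : nat, c1 + c2 * k%:R <= 2 ^+ k.
Proof.
pose j := (Num.trunc (`|c1| + 2 * `|c2|)).+1.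
exists (j + j)%N.
have c1j := ler_norm c1; have c2j := ler_norm c2.
have jlt : `|c1| + 2 * `|c2| < j%:R by exact: truncnS_gt.
have jexp : j%:R + 1 <= 2 ^+ j :> R.
  by rewrite natr1 -natrX ler_nat ltn_expl.
have j0 : 0 <= j%:R :> R by [].
rewrite natrD exprD.
have sq : (j%:R + 1) * (j%:R + 1) <= 2 ^+ j * 2 ^+ j :> R.
  by apply: ler_pM => //; lra.
apply: le_trans sq.
have : c2 * j%:R <= `|c2| * j%:R by apply: ler_wpM2r.
have : (`|c1| + 2 * `|c2|) * (j%:R + 1) <= j%:R * (j%:R + 1) by
  apply: ler_wpM2r; lra.
have := normr_ge0 c1; have := normr_ge0 c2.
have : 0 <= `|c1| * j%:R by apply: mulr_ge0.
nra.
Qed.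

Section Morse.
Context {R : realType} {M : metricType R}.
Variables (a mu S : R) (hyp : four_point M a) (geo : geodesic_space (M := M)).
Hypotheses (a0 : 0 <= a) (mu0 : 0 < mu) (S1 : 1 <= S).
Local Notation gp := (@gromov_product R M).

Local Ltac slra := have := a0; have := mu0; have := S1; lra.

(** Halving the chain, instead of adding points one by one, uses the four-point inequality to depth
    [k] only. *)
Lemma gp_chain p (x : nat -> M) r k i n : (0 < n <= 2 ^ k)%N ->
  (forall j, (i <= j < i + n)%N -> r <= gp p (x j) (x j.+1)) ->
  r - k%:R * a <= gp p (x i) (x (i + n)%N).
Proof.
elim: k i n => [|k IHk] i n /andP[n0 nk] step.
  have -> : n = 1%N by apply/eqP; rewrite eqn_leq nk n0.
  by rewrite mul0r subr0 addn1; apply: step; lia.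
have [nk'|kn] := leqP n (2 ^ k)%N.
  have := IHk i n; rewrite n0 nk' => /(_ isT step); rewrite -natr1; slra.
have k0 : (0 < 2 ^ k)%N by rewrite expn_gt0.
have nkk : (n <= 2 ^ k + 2 ^ k)%N by move: nk; rewrite expnS mul2n -addnn.
have s1 := IHk i (2 ^ k)%N; have s2 := IHk (i + 2 ^ k)%N (n - 2 ^ k)%N.
have -> : r - k.+1%:R * a = r - k%:R * a - a by rewrite -natr1; ring.
apply: (hyp (y := x (i + 2 ^ k)%N)).
  apply: s1; first by rewrite k0 leqnn.
  by move=> j ij; apply: step; lia.
have -> : (i + n = i + 2 ^ k + (n - 2 ^ k))%N by lia.
apply: s2; first by lia.
by move=> j ij; apply: step; lia.
Qed.

(** Only distances from the first point are bounded below; the divergence of two arms from each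
    other is a separate hypothesis of [morse_arms]. *)
Definition coarse_arm (x : nat -> M) (n : nat) : Prop :=
  (forall i, (i < n)%N -> mdist (x i) (x i.+1) <= S) /\
  (forall i, (i <= n)%N -> mu * i%:R - S <= mdist (x 0%N) (x i)).

(** Beyond index [2 ^ k] the arm hardly changes direction as seen from its start. Within one dyadic
    block consecutive products are at least [mu * 2 ^ k - 2 * S] and [gp_chain] loses [k * a]; the
    leading term doubles from block to block, so all later blocks together cost only one more
    [a]. *)
Lemma gp_arm x n k i : coarse_arm x n -> (2 ^ k <= i <= n)%N ->
  2 * a <= mu * 2 ^+ k ->
  mu * 2 ^+ k - 2 * S - (k%:R + 1) * a <= gp (x 0%N) (x (2 ^ k)%N) (x i).
Proof.
move=> [step away] /andP[ki iN] ak.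
have natX m : 2 ^+ m = (2 ^ m)%:R :> R by rewrite natrX.
have [m im] : exists m, (i <= 2 ^ (k + m))%N.
  exists i; apply: leq_trans (ltnW (ltn_expl i (ltnSn 1))) _.
  by rewrite leq_pexp2l ?leq_addl.
elim: m k ki im ak => [|m IHm] k ki im ak.
  have -> : i = (2 ^ k)%N by apply/eqP; rewrite eqn_leq ki -[k]addn0 im.
  rewrite gpxx metric_sym; have := away (2 ^ k)%N; rewrite natX.
  have : 0 <= (k%:R + 1) * a by apply: mulr_ge0.
  move=> h1 /(_ (leq_trans ki iN)); slra.
have stepk j : (2 ^ k <= j)%N -> (j < n)%N ->
    mu * 2 ^+ k - 2 * S <= gp (x 0%N) (x j) (x j.+1).
  move=> kj jn; have := away j (ltnW jn); have := step j jn.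
  have : mu * 2 ^+ k <= mu * j%:R by rewrite ler_pM2l// natX ler_nat.
  have := gp_lip (x 0%N) (x j.+1) (x j) (x j.+1).
  have := gp_lip2 (x 0%N) (x j) (x j) (x j.+1).
  rewrite gpxx (metric_sym (x j) (x 0%N)); slra.
have ex : mu * 2 ^+ k.+1 = 2 * (mu * 2 ^+ k) by rewrite exprS; ring.
have short i' : (2 ^ k < i' <= n)%N -> (i' <= 2 ^ k.+1)%N ->
    mu * 2 ^+ k - 2 * S - k%:R * a <= gp (x 0%N) (x (2 ^ k)%N) (x i').
  move=> ki' ik'; have -> : (i' = 2 ^ k + (i' - 2 ^ k))%N by lia.
  apply: gp_chain => [|j jk]; first by move: ik'; rewrite expnS; lia.
  by apply: stepk; lia.
have [ik|ki'] := leqP i (2 ^ k.+1)%N.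
  have [/eqP e|ne] := boolP (i == (2 ^ k)%N).
    rewrite e gpxx metric_sym; have := away (2 ^ k)%N; rewrite natX.
    have : 0 <= (k%:R + 1) * a by apply: mulr_ge0.
    move=> h1 /(_ (leq_trans ki iN)); slra.
  apply: le_trans (short i _ ik); first by slra.
  by rewrite ltn_neqAle eq_sym ne ki.
have -> : mu * 2 ^+ k - 2 * S - (k%:R + 1) * a
          = mu * 2 ^+ k - 2 * S - k%:R * a - a by ring.
apply: (hyp (y := x (2 ^ k.+1)%N)).
  apply: short => //; rewrite ltn_exp2l// ltnSn/=.
  by apply: leq_trans (ltnW ki') iN.
have ak' : 2 * a <= mu * 2 ^+ k.+1 by rewrite ex; slra.
apply: le_trans (IHm k.+1 (ltnW ki') _ ak'); last by rewrite addSnnS.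
by rewrite ex -[k.+1%:R]natr1; slra.
Qed.

(* The bound is logarithmic in the length [n] of the arm. *)
Lemma arm_near_geodesic x n k g : coarse_arm x n -> (n <= 2 ^ k)%N ->
  0 < g <= mdist (x 0%N) (x n) ->
  exists q, [/\ mdist q (x 0%N) = g, g <= gp (x 0%N) q (x n) &
    exists2 i, (i <= n)%N & mdist q (x i) < k%:R * a + 1 + S].
Proof.
move=> [step _] nk /andP[g0 gx]; have [l [f fg]] := geo (x 0%N) (x n).
have el := geodesic_length fg.
have [e1 e2] : mdist (x 0%N) (f g) = g /\ mdist (f g) (x n) = l - g.
  by apply: geodesic_split fg _; rewrite ltW//= -el.
exists (f g); split; first by rewrite metric_sym.
  by rewrite /gromov_product (metric_sym (x n)) el (metric_sym (f g) (x 0%N)) e1 e2; slra.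
have n0 : (0 < n)%N.
  by case: n gx {step nk fg el e2} => //; rewrite mdistxx; slra.
(* If all samples were farther from [f g], chaining would make the product of the two ends based at
   [f g] positive, while it is at most 0 as [f g] lies on a geodesic between them. *)
apply: contrapT => no.
have := @gp_chain (f g) x (k%:R * a + 1) k 0 n; rewrite n0 nk add0n => /(_ isT) H.
have : k%:R * a + 1 - k%:R * a <= gp (f g) (x 0%N) (x n).
  apply: H => j jn; rewrite leNgt; apply/negP => lt; apply: no; exists j; first lia.
  have := step j; rewrite (ltac:(lia) : (j < n)%N) => /(_ isT).
  have := gp_lip2 (f g) (x j) (x j) (x j.+1); rewrite gpxx metric_sym; slra.
have := gp_btw (f g) (q := f g) (x := x 0%N) (y := x n).
rewrite mdistxx el e1 e2 => /(_ ltac:(ring)); slra.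
Qed.

(* The constant is dictated by [morse_arms]: a geodesic bigon of width [g]
   forces two points of the arms that are far apart for the parametrization to
   be logarithmically close in [M]. *)
Definition morse_exponent (k : nat) : Prop :=
  2 * a <= mu * 2 ^+ k /\
  2 * S + (k%:R + 3) * a + k%:R * a + 1 + S
    + S * mu^-1 * (2 * (k%:R * a) + 3 * S + 2 + 4 * a) < mu * 2 ^+ k.

Lemma morse_exponent_ex : exists k, morse_exponent k.
Proof.
(* [c1] exceeds the constant term of the second condition by [2 * a + 1], which settles the first
   condition and the strictness of the second. *)
pose c1 := 2 * a + 3 * S + 3 * a + 2 + S * mu^-1 * (3 * S + 2 + 4 * a).
pose c2 := 2 * a + S * mu^-1 * (2 * a).
have [k] := linear_le_expn (mu^-1 * c1) (mu^-1 * c2).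
have -> : mu^-1 * c1 + mu^-1 * c2 * k%:R = mu^-1 * (c1 + c2 * k%:R) by ring.
rewrite ler_pdivrMl// => le; exists k; rewrite /morse_exponent.
have m0 : 0 < mu^-1 by rewrite invr_gt0.
have Sm : 0 <= S * mu^-1 by apply: mulr_ge0; slra.
have h1 : 0 <= S * mu^-1 * (3 * S + 2 + 4 * a) by apply: mulr_ge0; slra.
have h2 : 0 <= k%:R * a by apply: mulr_ge0.
have h3 : 0 <= S * mu^-1 * (2 * a) * k%:R by apply: mulr_ge0; rewrite // mulr_ge0//; slra.
rewrite /c1 /c2 in le.
have -> : S * mu^-1 * (2 * (k%:R * a) + 3 * S + 2 + 4 * a) =
  S * mu^-1 * (2 * a) * k%:R + S * mu^-1 * (3 * S + 2 + 4 * a) by ring.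
by split; slra.
Qed.

(** If the product were larger, [gp_arm] would allow cutting both arms at index [2 ^ k], which makes
    the error [k * a] of [arm_near_geodesic] independent of their lengths. On geodesics to the cut
    ends, the points at distance [g] from the start are [4 * a]-close, so samples [x i] and [y j]
    near them are close too. As steps have length at most [S], reaching them takes an index [i] of
    order [g / S], against the divergence of the arms. *)
Lemma morse_arms k x y n m : morse_exponent k ->
  coarse_arm x n -> coarse_arm y m -> x 0%N = y 0%N ->
  (forall i j, (i <= n)%N -> (j <= m)%N ->
     mu * (i%:R + j%:R) - S <= mdist (x i) (y j)) ->
  gp (x 0%N) (x n) (y m) <= mu * 2 ^+ k - 2 * S - (k%:R + 1) * a.
Proof.
move=> [ak big] ax ay xy apart.
set B := _ - (k%:R + 1) * a; rewrite leNgt; apply/negP => gt.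
pose n' := minn n (2 ^ k); pose m' := minn m (2 ^ k).
have ka0 : 0 <= k%:R * a by apply: mulr_ge0.
have trunc z l : coarse_arm z l ->
    minn l (2 ^ k) = l \/ B <= gp (z 0%N) (z (minn l (2 ^ k))%N) (z l).
  move=> az; have [lk|kl] := leqP l (2 ^ k)%N; first by left.
  by right; apply: gp_arm az _ ak; rewrite (ltnW kl) leqnn.
have s1 : B - a <= gp (x 0%N) (x n') (y m).
  have [e|le] := trunc _ _ ax; first by rewrite /n' e; slra.
  exact: hyp le (ltW gt).
have s2 : B - a - a <= gp (x 0%N) (x n') (y m').
  have [e|] := trunc _ _ ay; first by rewrite /m' e; slra.
  rewrite -xy gpC => le; apply: hyp s1 _; slra.
set g := B - a - a in s2.
have Smu : 0 <= S * mu^-1 by apply: mulr_ge0; rewrite ?invr_ge0; slra.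
have big2 : 0 <= S * mu^-1 * (2 * (k%:R * a) + 3 * S + 2 + 4 * a).
  by apply: mulr_ge0 => //; slra.
have gval : g = mu * 2 ^+ k - 2 * S - (k%:R + 3) * a by rewrite /g /B; ring.
have g0 : 0 < g by slra.
have sub z l : coarse_arm z l -> coarse_arm z (minn l (2 ^ k)).
  move=> [h1 h2]; have lel := geq_minl l (2 ^ k).
  by split=> i il; [apply: h1|apply: h2]; apply: leq_trans il lel.
have gx : g <= mdist (x 0%N) (x n').
  by rewrite metric_sym; apply: le_trans s2 (gp_le_dist _ _ _).
have gy : g <= mdist (y 0%N) (y m').
  by rewrite metric_sym -xy; apply: le_trans s2 _; rewrite gpC gp_le_dist.
have [|q [qd qg [i il qi]]] :=
    arm_near_geodesic (k := k) (g := g) (sub _ _ ax) (geq_minr _ _).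
  by rewrite g0.
have [|q' [qd' qg' [j jl qj]]] :=
    arm_near_geodesic (k := k) (g := g) (sub _ _ ay) (geq_minr _ _).
  by rewrite g0.
have qq : g - a - a <= gp (x 0%N) q q'.
  apply: (hyp (y := y m')); first by apply: hyp qg s2.
  by rewrite gpC xy; slra.
have qq4 : mdist q q' <= 4 * a.
  by move: qq; rewrite /gromov_product qd xy qd'; slra.
have il' : (i <= n)%N by apply: leq_trans il (geq_minl _ _).
have xi : g - (k%:R * a + 1 + S) <= S * i%:R.
  have : mdist (x 0%N) (x i) <= S * i%:R.
    elim: (i) il' => [|i' IHi] lt; first by rewrite mdistxx mulr0.
    have := IHi (ltnW lt); have := ax.1 i' lt.
    have := metric_triangle (x 0%N) (x i') (x i'.+1); rewrite -natr1; slra.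
  have := metric_triangle (x 0%N) (x i) q; rewrite (metric_sym (x i) q).
  rewrite (metric_sym (x 0%N) q) qd; slra.
have ij := apart i j il' (leq_trans jl (geq_minl _ _)).
have ij2 : mdist (x i) (y j) <= 2 * (k%:R * a + 1 + S) + 4 * a.
  have := metric_triangle (x i) q (y j); have := metric_triangle q q' (y j).
  rewrite (metric_sym (x i) q); slra.
have imu : mu * i%:R <= 2 * (k%:R * a) + 3 * S + 2 + 4 * a.
  have : 0 <= mu * j%:R by apply: mulr_ge0 => //; slra.
  by move: ij; rewrite mulrDr; slra.
have : S * i%:R <= S * mu^-1 * (2 * (k%:R * a) + 3 * S + 2 + 4 * a).
  rewrite -mulrA ler_pM2l; last by slra.
  by rewrite ler_pdivlMl.
slra.
Qed.

End Morse.

(** * The Gromov boundary *)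

Section Boundary.
Context {R : realType} {M : metricType R}.
Variables (a : R) (hyp : four_point M a).
Local Notation gp := (@gromov_product R M).
Implicit Types (u v w : nat -> M) (F G : R -> set M) (b : set (nat -> M)).

Lemma asymptotic_base p0 u v :
  (forall r, exists k : nat, forall i j, (k <= i)%N -> (k <= j)%N ->
     r <= gp p0 (u i) (v j)) -> asymptotic u v.
Proof.
move=> uv p r; have [k kuv] := uv (r + mdist p0 p).
exists k => i j ki kj; have := kuv i j ki kj.
have := gp_lip0 p0 p (u i) (v j); lra.
Qed.

Lemma asymptotic_sym u v : asymptotic u v -> asymptotic v u.
Proof.
move=> uv p r; have [k kuv] := uv p r; exists k => i j ki kj.
by rewrite gpC; apply: kuv.
Qed.

Lemma asymptotic_trans v u w :
  asymptotic u v -> asymptotic v w -> asymptotic u w.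
Proof.
move=> uv vw p r; have [k kuv] := uv p (r + a); have [l lvw] := vw p (r + a).
exists (maxn k l) => i j; rewrite !geq_max => /andP[ki li] /andP[kj lj].
rewrite -[r](addrK a).
by apply: (hyp (y := v (maxn k l))); [apply: kuv|apply: lvw];
  rewrite ?leq_maxl ?leq_maxr.
Qed.

Lemma boundary_asymptotic b u v : gromov_boundary M b -> b u -> b v ->
  asymptotic u v.
Proof.
by move=> [w _ ->] [_ wu] [_ wv]; apply: asymptotic_trans wv; apply: asymptotic_sym.
Qed.

Lemma boundary_eq b b' u v : gromov_boundary M b -> gromov_boundary M b' ->
  b u -> b' v -> asymptotic u v -> b = b'.
Proof.
have sub c c' u' v' : gromov_boundary M c -> gromov_boundary M c' ->
    c u' -> c' v' -> asymptotic u' v' -> c `<=` c'.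
  move=> cb [w' _ ->] cu [_ wv] uv w cw.
  have uw := boundary_asymptotic cb cu cw.
  split; first by have [x _ e] := cb; rewrite e in cw; case: cw.
  by apply: asymptotic_trans uw; apply: asymptotic_trans wv _; apply: asymptotic_sym.
move=> bb bb' bu bv uv; apply/seteqP; split; first exact: (sub b b' u v).
exact: (sub b' b v u bb' bb bv bu (asymptotic_sym uv)).
Qed.

Lemma cvg_of_ge_nat (t : nat -> R) : (forall n, n%:R <= t n) -> t @ \oo --> +oo.
Proof.
move=> nt; apply/cvgryPge => B; near=> n; apply: le_trans (nt n).
by near: n; exact: nbhs_infty_ger.
Unshelve. all: by end_near. Qed.

(** The sequential definition of [tends_to] is in fact uniform: failures at all times [n] would
    give, by choice, two sequences in the class [b] with bounded products. *)
Lemma tends_to_gp F G b : tends_to F b -> tends_to G b ->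
  forall p B, exists T, forall s t x y, T <= s -> T <= t -> F s x -> G t y ->
    B <= gp p x y.
Proof.
move=> [bb Fb] [_ Gb] p B; apply: contrapT => no.
have /choice[z zP] (n : nat) : exists z : (R * R) * (M * M),
    [/\ n%:R <= z.1.1, n%:R <= z.1.2, F z.1.1 z.2.1, G z.1.2 z.2.2 &
        gp p z.2.1 z.2.2 < B].
  apply: contrapT => no'; apply: no; exists n%:R => s t x y ns nt Fx Gy.
  by rewrite leNgt; apply/negP => lt; apply: no'; exists ((s, t), (x, y)).
have bx : b (fun n => (z n).2.1).
  apply: (Fb (fun n => (z n).1.1)) => [|n]; last by have [] := zP n.
  by apply: cvg_of_ge_nat => n; have [] := zP n.
have by_ : b (fun n => (z n).2.2).
  apply: (Gb (fun n => (z n).1.2)) => [|n]; last by have [] := zP n.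
  by apply: cvg_of_ge_nat => n; have [] := zP n.
have [k kxy] := boundary_asymptotic bb bx by_ p B.
have := kxy k k (leqnn k) (leqnn k); have [_ _ _ _] := zP k; lra.
Qed.

Lemma tends_to_escape F b q B : tends_to F b ->
  exists T, forall t x, T <= t -> F t x -> B <= mdist q x.
Proof.
move=> Fb; have [T TB] := tends_to_gp Fb Fb q B; exists T => t x Tt Fx.
by have := TB t t x x Tt Tt Fx Fx; rewrite gpxx metric_sym.
Qed.

(** Otherwise two sequences at bounded distance from each other, hence asymptotic, would represent
    [b] and [b']. *)
Lemma tends_to_far F G b b' B : tends_to F b -> tends_to G b' -> b <> b' ->
  exists T, forall s t x y, T <= s -> T <= t -> F s x -> G t y ->
    B <= mdist x y.
Proof.
move=> [bb Fb] [bb' Gb] nbb'; apply: contrapT => no; apply: nbb'.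
have /choice[z zP] (n : nat) : exists z : (R * R) * (M * M),
    [/\ n%:R <= z.1.1, n%:R <= z.1.2, F z.1.1 z.2.1, G z.1.2 z.2.2 &
        mdist z.2.1 z.2.2 < B].
  apply: contrapT => no'; apply: no; exists n%:R => s t x y ns nt Fx Gy.
  by rewrite leNgt; apply/negP => lt; apply: no'; exists ((s, t), (x, y)).
have bx : b (fun n => (z n).2.1).
  apply: (Fb (fun n => (z n).1.1)) => [|n]; last by have [] := zP n.
  by apply: cvg_of_ge_nat => n; have [] := zP n.
have by_ : b' (fun n => (z n).2.2).
  apply: (Gb (fun n => (z n).1.2)) => [|n]; last by have [] := zP n.
  by apply: cvg_of_ge_nat => n; have [] := zP n.
apply: (boundary_eq bb bb' bx by_) => p r.
have [k kx] := boundary_asymptotic bb bx bx p (r + B).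
exists k => i j ki kj; have := kx i j ki kj; have [_ _ _ _] := zP j.
have := gp_lip2 p (z i).2.1 (z j).2.1 (z j).2.2; lra.
Qed.

Lemma cauchy_tends_to F p :
  (forall t, 0 <= t -> F t !=set0) ->
  (forall B, exists T, forall s t x y, T <= s -> T <= t -> F s x -> F t y ->
     B <= gp p x y) ->
  exists b, tends_to F b.
Proof.
move=> Fne cau.
have /choice[u uP] (n : nat) : exists x, F n%:R x by exact: Fne.
have asym (s t : nat -> R) x y : s @ \oo --> +oo -> t @ \oo --> +oo ->
    (forall n, F (s n) (x n)) -> (forall n, F (t n) (y n)) -> asymptotic x y.
  move=> /cvgryPge soo /cvgryPge too Fx Fy; apply: (asymptotic_base (p0 := p)) => r.
  have [T TB] := cau r.
  have [k _ kP] : \forall n \near \oo, T <= s n /\ T <= t n.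
    by near=> n; split; near: n; [apply: soo|apply: too].
  by exists k => i j ki kj; apply: (TB (s i) (t j)) => //; [case: (kP i)|case: (kP j)].
have natoo : (fun n : nat => n%:R) @ \oo --> (+oo : set_system R).
  exact: cvg_of_ge_nat.
have uu : converges_at_infinity u by exact: (asym _ _ _ _ natoo natoo).
exists [set v | converges_at_infinity v /\ asymptotic u v]; split.
  by exists u.
move=> t v too Fv; split; first exact: (asym _ _ _ _ too too Fv Fv).
exact: (asym _ _ _ _ natoo too uP Fv).
Unshelve. all: by end_near. Qed.

End Boundary.

Section BoundaryRay.
Context {R : realType} {M : metricType R}.
Variables (delta : R) (hyp : hyperbolic M delta).
Local Notation gp := (@gromov_product R M).

(** The third side stays at distance at least the product from [p], so slimness puts [f t] near the
    other geodesic. There is no additive constant in the bound because [delta] may be 0, while the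
    rays of [far_points] are [(1, 20 * delta)]-quasigeodesics. *)
Lemma geodesic_fellow_travel p x y l m (f g : R -> M) t :
  geodesic_segment l f p x -> geodesic_segment m g p y ->
  0 <= t -> t + delta < gp p x y -> mdist (f t) (g t) <= 2 * delta.
Proof.
have [d0 geo slim] := hyp; move=> gf gg t0 tlt.
have [k [e ge]] := geo x y.
have lx := geodesic_length gf; have ly := geodesic_length gg.
have gxl := gp_le_dist p x y; have gyl := gp_le_dist p y x.
rewrite gpC in gyl.
rewrite metric_sym lx in gxl; rewrite metric_sym ly in gyl.
have tl : 0 <= t <= l by rewrite t0; lra.
have tm : 0 <= t <= m by rewrite t0; lra.
have [ft1 ft2] := geodesic_split gf tl; have [gt1 gt2] := geodesic_split gg tm.
rewrite leNgt; apply/negP => big.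
(* Slimness bounds an infimum, so some slack is unavoidable; [eps] keeps [2 * (delta + eps)] within
   the supposed distance and [t + delta + eps] below the product. *)
pose eps := Num.min ((mdist (f t) (g t) - 2 * delta) / 2)
  ((gp p x y - t - delta) / 2).
have e1 : eps <= (mdist (f t) (g t) - 2 * delta) / 2 by rewrite ge_min lexx.
have e2 : eps <= (gp p x y - t - delta) / 2 by rewrite ge_min lexx orbT.
have e0 : 0 < eps by rewrite lt_min; apply/andP; split; lra.
have : nbhd_of delta (e @` `[0, k] `|` g @` `[0, m]) (f t).
  by apply: (slim _ _ _ _ _ _ _ _ _ gf ge gg); exists t; rewrite //= in_itv.
move=> /(setdist_lt (r' := delta + eps))[|x1 [y1 [-> [[s]|[s]]]]]; first by lra.
  rewrite /= in_itv/= => sk <- near; have := gp_geodesic p ge sk.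
  have := metric_triangle p (f t) (e s); lra.
rewrite /= in_itv/= => sm <- near; have [gs _] := geodesic_split gg sm.
have [_ gg_geo _ _] := gg.
have := metric_triangle p (f t) (g s); have := metric_triangle p (g s) (f t).
have := metric_triangle (f t) (g s) (g t).
have -> : mdist (g s) (g t) = `|s - t| by apply: gg_geo; rewrite /= in_itv.
rewrite (metric_sym (g s) (f t)).
by case: (ger0P (s - t)); lra.
Qed.

(* The ray runs along geodesics from [p] to points converging to [b], switching
   to a further one at each integer time. *)
Lemma boundary_ray p b : gromov_boundary M b ->
  exists g : R -> M, [/\ quasigeodesic 1 (2 * delta) `[0, +oo[ g, g 0 = p &
    tends_to (fun t => [set g t]) b].
Proof.
move=> bb; have [d0 geo _] := hyp; have four := slim_four_point hyp.
have [u uu bE] := bb.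
have /choice[n nP] (k : nat) : exists n : nat, forall i j, (n <= i)%N ->
    (n <= j)%N -> k%:R + 2 + delta <= gp p (u i) (u j) by exact: uu.
(* Partial sums make the indices monotone. The margin [k + 2 + delta] makes the geodesics of stages
   [k] and later fellow travel up to time [k + 1], when [g] leaves the one of stage [k]. *)
pose m k := (\sum_(0 <= i < k.+1) n i)%N.
have nm k : (n k <= m k)%N by rewrite /m big_nat_recr//= leq_addl.
have mm k l : (k <= l)%N -> (m k <= m l)%N.
  by move=> kl; rewrite /m [leqRHS](@big_cat_nat _ _ _ k.+1)//= leq_addr.
have far k l l' : (k <= l)%N -> (k <= l')%N ->
    k%:R + 2 + delta <= gp p (u (m l)) (u (m l')).
  by move=> kl kl'; apply: nP; apply: leq_trans (nm k) _; apply: mm.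
have /choice[f fP] (k : nat) : exists f, geodesic_segment (mdist p (u (m k))) f p (u (m k)).
  have [l [f fl]] := geo p (u (m k)); exists f.
  by rewrite (geodesic_length fl).
have long k : k%:R + 2 + delta <= mdist p (u (m k)).
  by rewrite metric_sym; apply: le_trans (gp_le_dist _ _ _); apply: far (leqnn k).
pose g t := f (Num.trunc t) t.
have gE s t : 0 <= s -> s <= t ->
    t - s - 2 * delta <= mdist (g s) (g t) <= t - s + 2 * delta.
  move=> s0 st; have t0 := le_trans s0 st.
  have sT := truncnS_gt s; have tT := truncnS_gt t.
  have kl : (Num.trunc s <= Num.trunc t)%N by exact: le_truncn.
  have ft : mdist (f (Num.trunc s) s) (f (Num.trunc t) s) <= 2 * delta.
    apply: geodesic_fellow_travel (fP _) (fP _) s0 _.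
    have := far _ _ _ (leqnn _) kl; rewrite -natr1 in sT; lra.
  have e : mdist (f (Num.trunc t) s) (g t) = t - s.
    have [_ fg _ _] := fP (Num.trunc t).
    rewrite fg/= ?in_itv/= ?s0 ?t0/=; first by rewrite distrC ger0_norm ?subr_ge0.
      by apply: le_trans st _; have := long (Num.trunc t); rewrite -natr1 in tT; lra.
    by have := long (Num.trunc t); rewrite -natr1 in tT; lra.
  have := metric_triangle (g s) (f (Num.trunc t) s) (g t).
  have := metric_triangle (f (Num.trunc t) s) (g s) (g t).
  rewrite e (metric_sym (f (Num.trunc t) s) (g s)) /g.
  by move=> h1 h2; apply/andP; split; rewrite /g in ft *; lra.
exists g; split.
- move=> s t; rewrite /= !in_itv/= !andbT => s0 t0; rewrite invr1 !mul1r.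
  have [st|ts] := leP s t.
    by rewrite distrC ger0_norm ?subr_ge0//; exact: gE.
  by rewrite metric_sym gtr0_norm ?subr_gt0//; apply: gE => //; exact: ltW.
- by rewrite /g truncn0; have [_ _ ->] := fP 0%N.
split=> // t w too gw.
have gw' i : w i = g (t i) by have := gw i.
rewrite bE; suff uw : asymptotic u w.
  by split=> //; exact: (asymptotic_trans four (asymptotic_sym uw) uw).
apply: (asymptotic_base (p0 := p)) => r.
pose B := `|r| + (3 * delta + 4); pose K := (Num.trunc B).+1.
have BK : B < K%:R by exact: truncnS_gt.
have rB : r <= `|r| by exact: ler_norm.
move: too => /cvgryPge /(_ K%:R)[k0 _ k0P].
exists (maxn k0 (m K)) => i j; rewrite !geq_max => /andP[_ mi] /andP[kj _].
have tj := k0P j kj; rewrite /= in tj.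
have t0 : 0 <= t j by apply: le_trans tj.
have Kj : (K <= Num.trunc (t j))%N by rewrite truncn_ge_nat.
have -> : r = r + (3 * delta + 4) - (3 * delta + 4) by ring.
apply: (four _ _ (u (m (Num.trunc (t j))))).
  apply: (@le_trans _ _ (K%:R + 2 + delta)); first by rewrite /B in BK; lra.
  by apply: nP; [apply: leq_trans (nm K) mi|apply: leq_trans (nm K) (mm _ _ Kj)].
have tin : 0 <= t j <= mdist p (u (m (Num.trunc (t j)))).
  rewrite t0/=; have := long (Num.trunc (t j)); have := truncnS_gt (t j).
  by rewrite -natr1; lra.
have [e1 e2] := geodesic_split (fP (Num.trunc (t j))) tin.
rewrite gw' gpC /gromov_product (metric_sym (g (t j)) p).
by rewrite (metric_sym _ p) /g e1 e2; rewrite /B in BK; lra.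
Qed.

End BoundaryRay.

(** * Unparametrized quasigeodesic rays and their Morse property *)

Section CoarseRay.
Context {R : realType} {M : metricType R}.
Variables (A : R) (A1 : 1 <= A).
Local Notation gp := (@gromov_product R M).
Implicit Types (F : R -> set M) (phi : R -> R).

(** The pointwise form of [unparam_quasigeodesic]. The intermediate values of [phi] replace
    continuity and permit sampling at unit steps of [phi]; bounded images are allowed. *)
Definition coarse_ray_by phi F : Prop :=
  [/\ forall t : R, 0 <= t -> F t !=set0,
      forall s t : R, 0 <= s -> s <= t -> phi s <= phi t,
      forall s t r : R, 0 <= s -> 0 <= t -> phi s <= r <= phi t ->
        exists2 r' : R, 0 <= r' & phi r' = r
    & forall (s t : R) u v, 0 <= s -> 0 <= t -> F s u -> F t v ->
        A^-1 * `|phi s - phi t| - A <= mdist u v <= A * `|phi s - phi t| + A].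

Definition coarse_ray F : Prop := exists phi, coarse_ray_by phi F.

(** The sign [e] is the direction of travel, so that both arms issuing from a middle point are
    covered. The last sample misses [phi t] by at most 1, whence [2 * A]. *)
Lemma coarse_ray_samples phi F s t v w (e : R) : coarse_ray_by phi F ->
  0 <= s -> 0 <= t -> F s v -> F t w -> `|e| = 1 -> 0 <= e * (phi t - phi s) ->
  exists (n : nat) (x : nat -> M) (r : nat -> R),
    [/\ x 0%N = v,
        forall i, (i <= n)%N ->
          [/\ 0 <= r i, F (r i) (x i) & phi (r i) = phi s + e * i%:R]
      & mdist (x n) w <= 2 * A].
Proof.
have A0 : 0 < A by have := A1; lra.
move=> [Fne mono onto qi] s0 t0 Fv Fw e1 est.
have ee : e * e = 1.
  by case: (ger0P e) e1 => _; [move=> ->; ring|move=> h; rewrite -[e]opprK h; ring].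
pose n := Num.trunc (e * (phi t - phi s)).
have [nle nlt] := andP (truncn_itv est); rewrite -/n in nle nlt.
(* The clause for [i = 0] makes the samples start at [v] itself, and not at another point over the
   same value of [phi]. *)
have /choice[z zP] (i : nat) : exists z : R * M, (i <= n)%N ->
    [/\ 0 <= z.1, F z.1 z.2, phi z.1 = phi s + e * i%:R & i = 0%N -> z.2 = v].
  case: i => [|i]; first by exists (s, v) => _; split=> //=; rewrite mulr0 addr0.
  have [iN|] := leqP i.+1 n; last by exists (s, v).
  have ile : i.+1%:R <= e * (phi t - phi s).
    by apply: le_trans nle; rewrite ler_nat.
  have i0 : 0 <= i.+1%:R :> R by [].
  have [r r0 rE] : exists2 r, 0 <= r & phi r = phi s + e * i.+1%:R.
    case: (ger0P e) e1 ile => _ eE; rewrite ?eE ?mul1r => ile.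
      by apply: (onto s t) => //; apply/andP; split; lra.
    have {}eE : e = -1 by rewrite -[e]opprK eE.
    rewrite eE !mulN1r in ile *.
    by apply: (onto t s) => //; apply/andP; split; lra.
  by have [x Fx] := Fne r r0; exists (r, x).
exists n, (fun i => (z i).2), (fun i => (z i).1); split.
- by have [_ _ _] := zP 0%N (leq0n n); apply.
- by move=> i /zP[].
have [r0 Fr rE _] := zP n (leqnn n).
have /andP[_ h] := qi _ _ _ _ r0 t0 Fr Fw.
apply: le_trans h _.
suff : `|phi (z n).1 - phi t| <= 1.
  move=> h; have : A * `|phi (z n).1 - phi t| <= A * 1 by rewrite ler_pM2l.
  lra.
have -> : phi (z n).1 - phi t = - e * (e * (phi t - phi s) - n%:R).
  have -> : - e * (e * (phi t - phi s) - n%:R)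
            = - (e * e) * (phi t - phi s) + e * n%:R by ring.
  by rewrite ee rE; ring.
rewrite normrM normrN e1 mul1r ger0_norm ?subr_ge0//.
by rewrite -natr1 in nlt; lra.
Qed.

(** A bounded [phi] would give an image of finite diameter; once [phi] is unbounded, its
    monotonicity makes the divergence uniform over all later times. *)
Lemma coarse_ray_escape F : coarse_ray F ->
  diam (\bigcup_(t in `[0, +oo[%classic) F t) = +oo%E ->
  forall q B, exists2 T, 0 <= T & forall t u, T <= t -> F t u -> B <= mdist q u.
Proof.
have A0 : 0 < A by have := A1; lra.
have Ai : 0 < A^-1 by rewrite invr_gt0.
move=> [phi [Fne mono onto qi]] Foo q B.
pose FU := \bigcup_(t in `[0, +oo[%classic) F t.
have unb C : exists2 t : R, 0 <= t & C <= phi t.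
  apply: contrapT => no.
  have phi_le (t : R) : 0 <= t -> phi t <= C.
    by move=> t0; rewrite leNgt; apply/negP => lt; apply: no; exists t => //; exact: ltW.
  have : (diam FU <= (A * (C - phi 0) + A)%:E)%E.
    apply: diam_le => [|x y [s + Fx] [t + Fy]].
      have : 0 <= A * (C - phi 0).
        by apply: mulr_ge0; [exact: ltW|rewrite subr_ge0; apply: phi_le].
      lra.
    rewrite /= !in_itv/= !andbT => s0 t0.
    have /andP[_ h] := qi _ _ _ _ s0 t0 Fx Fy; apply: le_trans h _.
    rewrite lerD2r ler_pM2l//.
    have := phi_le _ s0; have := phi_le _ t0.
    have := mono _ _ (lexx 0) s0; have := mono _ _ (lexx 0) t0.
    by rewrite ler_norml => *; apply/andP; split; lra.
  by rewrite /FU Foo.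
have [x0 Fx0] := Fne 0 (lexx 0).
have [T T0 TB] := unb (phi 0 + A * (B + mdist q x0 + A)).
exists T => // t u Tt Fu; have t0 := le_trans T0 Tt.
have /andP[h _] := qi _ _ _ _ (lexx 0) t0 Fx0 Fu.
have := mono _ _ T0 Tt; have := mono _ _ (lexx 0) T0 => p1 p2.
have : A^-1 * (A * (B + mdist q x0 + A)) <= A^-1 * `|phi 0 - phi t|.
  by rewrite ler_pM2l// distrC; apply: le_trans (ler_norm _); lra.
rewrite mulrA mulVf ?gt_eqF// mul1r.
have := metric_triangle x0 q u; rewrite (metric_sym x0 q); lra.
Qed.

(** A finite diameter bounds [phi]; after a time at which [phi] is within 1 of its supremum, its
    values differ by at most 1. *)
Lemma coarse_ray_stabilizes F : coarse_ray F ->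
  diam (\bigcup_(t in `[0, +oo[%classic) F t) <> +oo%E ->
  exists2 T, 0 <= T & forall s t u v, T <= s -> T <= t -> F s u -> F t v ->
    mdist u v <= 2 * A.
Proof.
have A0 : 0 < A by have := A1; lra.
have Ai : 0 < A^-1 by rewrite invr_gt0.
move=> [phi [Fne mono onto qi]] Foo.
pose FU := \bigcup_(t in `[0, +oo[%classic) F t.
have [r rD] : exists r, (diam FU <= r%:E)%E.
  move: Foo; rewrite -/FU; case: (diam _) => [r _|//|_]; first by exists r.
  by exists 0; rewrite leNye.
have [x0 Fx0] := Fne 0 (lexx 0).
have F0 : FU x0.
  by exists 0 => //; rewrite /= in_itv/= lexx.
have bnd (t : R) : 0 <= t -> phi t <= phi 0 + A * (r + A).
  move=> t0; have [x Fx] := Fne t t0.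
  have : mdist x0 x <= r.
    by apply: diam_ub rD _ _ => //; exists t => //; rewrite /= in_itv/= t0.
  have /andP[h _] := qi _ _ _ _ (lexx 0) t0 Fx0 Fx; move=> h'.
  have : A^-1 * `|phi 0 - phi t| <= r + A by lra.
  by rewrite ler_pdivrMl// distrC; have := ler_norm (phi t - phi 0); lra.
pose E := phi @` [set t | 0 <= t].
have supE : has_sup E.
  split; first by exists (phi 0), 0 => /=.
  by exists (phi 0 + A * (r + A)) => _ [t t0 <-]; apply: bnd.
have [_ [T T0 <-] lt] := sup_adherent (ltr01 : 0 < 1 :> R) supE.
exists T => // s t u v Ts Tt Fu Fv.
have s0 := le_trans T0 Ts; have t0 := le_trans T0 Tt.
have /andP[_ h] := qi _ _ _ _ s0 t0 Fu Fv; apply: le_trans h _.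
have : phi s <= sup E by apply: sup_upper_bound supE _ _; exists s.
have : phi t <= sup E by apply: sup_upper_bound supE _ _; exists t.
have := mono _ _ T0 Ts; have := mono _ _ T0 Tt => p1 p2 p3 p4.
suff : A * `|phi s - phi t| <= A * 1 by lra.
by rewrite ler_pM2l// ler_norml; apply/andP; split; lra.
Qed.

End CoarseRay.

(** The two arms are samples issuing from the middle point [y]. [D] is chosen before the space, so
    that one constant serves every [C H U]; [4 * A] pays for the ends of the samples, which are only
    [2 * A]-close to [x] and [z]. *)
Lemma coarse_ray_morse (R : realType) (a A : R) : 0 <= a -> 1 <= A ->
  exists2 D, 0 <= D & forall (M : metricType R) (F : R -> set M),
    four_point M a -> geodesic_space (M := M) -> coarse_ray A F ->
    forall s t u x y z, 0 <= s -> s <= t -> t <= u -> F s x -> F t y -> F u z ->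
      gromov_product y x z <= D.
Proof.
move=> a0 A1; have Ai : 0 < A^-1 by rewrite invr_gt0; lra.
have S1 : 1 <= 2 * A by lra.
have [k kP] := morse_exponent_ex a0 Ai S1.
pose B := A^-1 * 2 ^+ k - 2 * (2 * A) - (k%:R + 1) * a.
exists (`|B| + 4 * A); first by rewrite addr_ge0// mulr_ge0//; lra.
move=> M F four geo [phi ray] s t u x y z s0 st tu Fx Fy Fz.
have t0 := le_trans s0 st; have u0 := le_trans t0 tu.
have [Fne mono onto qi] := ray.
have [||n [xs [r [xs0 xsP xsn]]]] :=
    coarse_ray_samples A1 (e := -1) ray t0 s0 Fy Fx.
- by rewrite normrN1.
- by rewrite mulN1r opprB subr_ge0; apply: mono.
have [||m [zs [r' [zs0 zsP zsm]]]] :=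
    coarse_ray_samples A1 (e := 1) ray t0 u0 Fy Fz.
- by rewrite normr1.
- by rewrite mul1r subr_ge0; apply: mono.
have arm ys (q : nat -> R) l e : `|e| = 1 ->
    (forall i, (i <= l)%N ->
          [/\ 0 <= q i, F (q i) (ys i) & phi (q i) = phi t + e * i%:R]) ->
    coarse_arm A^-1 (2 * A) ys l.
  move=> e1 ysP; split=> i il.
    have [q0 Fq qE] := ysP i (ltnW il); have [q0' Fq' qE'] := ysP _ il.
    have /andP[_ h] := qi _ _ _ _ q0 q0' Fq Fq'; apply: le_trans h _.
    rewrite qE qE'; have -> : phi t + e * i%:R - (phi t + e * i.+1%:R) = - e.
      by rewrite -natr1; ring.
    by rewrite normrN e1; lra.
  have [q0 Fq qE] := ysP i il; have [q0' Fq' qE'] := ysP 0%N (leq0n _).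
  have /andP[h _] := qi _ _ _ _ q0' q0 Fq' Fq; apply: le_trans h.
  rewrite qE qE' mulr0 addr0 opprD addNKr normrN normrM e1 mul1r normr_nat; lra.
have key : gromov_product (xs 0%N) (xs n) (zs m) <= B.
  apply: (morse_arms four geo a0 Ai S1 kP).
  - by apply: arm xsP; rewrite normrN1.
  - by apply: arm zsP; rewrite normr1.
  - by rewrite xs0 zs0.
  move=> i j il jl; have [q0 Fq qE] := xsP i il; have [q0' Fq' qE'] := zsP j jl.
  have /andP[h _] := qi _ _ _ _ q0 q0' Fq Fq'; apply: le_trans h.
  rewrite qE qE'.
  have -> : phi t + -1 * i%:R - (phi t + 1 * j%:R) = - (i%:R + j%:R) by ring.
  rewrite normrN ger0_norm; last by rewrite addr_ge0.
  lra.
rewrite xs0 in key; have := ler_norm B.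
have := gp_lip y x (xs n) z; have := gp_lip2 y (xs n) z (zs m).
rewrite (metric_sym x) (metric_sym z); lra.
Qed.

Section InfiniteRay.
Context {R : realType} {M : metricType R}.
Variables (a A : R) (four : four_point M a) (geo : geodesic_space (M := M)).
Hypotheses (a0 : 0 <= a) (A1 : 1 <= A).

Lemma coarse_ray_tends_to (F : R -> set M) : coarse_ray A F ->
  diam (\bigcup_(t in `[0, +oo[%classic) F t) = +oo%E ->
  exists b, tends_to F b.
Proof.
move=> ray Foo; have [D D0 DP] := coarse_ray_morse a0 A1.
have [phi [Fne _ _ _]] := ray.
have [p Fp] := Fne 0 (lexx 0).
apply: (cauchy_tends_to (p := p)) => // B.
have [T T0 TB] := coarse_ray_escape A1 ray Foo p (B + D).
exists T.
have main s t x y : T <= s -> s <= t -> F s x -> F t y ->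
    B <= gromov_product p x y.
  move=> Ts st Fx Fy; have s0 := le_trans T0 Ts.
  (* By [gp_sum] the product at [p] is the distance from [p] to [x], which diverges, minus the
     product at [x], which the Morse property bounds. *)
  have := DP M F four geo ray 0 s t p x y (lexx 0) s0 st Fp Fx Fy.
  by have := TB s x Ts Fx; have := gp_sum p x y; lra.
move=> s t x y Ts Tt Fx Fy; have [st|ts] := leP s t; first exact: main st Fx Fy.
by rewrite gpC; apply: main (ltW ts) Fy Fx.
Qed.

End InfiniteRay.

(** * Passing up for two points *)

Section CoarseHHS.
Context {R : realType} {d : Order.disp_t}.
Context {X : metricType R} {Dom : porderType d}.
Implicit Types (H : hhs_data X Dom) (T U V W : Dom) (x y : X).

(* The axioms of [is_hhs] that the proof uses, with bounds on sets unfolded to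
   bounds on points and with a single constant [A]. *)
Record coarse_hhs H (A : R) : Prop := CoarseHHS {
  chhs_ge1 : 1 <= A;
  chhs_four_point : forall W, four_point (C H W) A;
  chhs_geodesic : forall W, geodesic_space (M := C H W);
  chhs_near : forall W (p : C H W) l f u v, geodesic_segment l f u v ->
    exists2 t, 0 <= t <= l & mdist p (f t) <= gromov_product p u v + A;
  chhs_proj_neq0 : forall W x, proj H W x !=set0;
  chhs_proj_diam : forall W x u v, proj H W x u -> proj H W x v ->
    mdist u v <= A;
  chhs_rho_neq0 : forall V W, (V < W)%O \/ transverse H V W ->
    rho H V W !=set0;
  chhs_rho_diam : forall V W u v, (V < W)%O \/ transverse H V W ->
    rho H V W u -> rho H V W v -> mdist u v <= A;
  chhs_rhomap_neq0 : forall V W, (V < W)%O -> forall p : C H W,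
    rhomap H V p !=set0;
  chhs_orthC : forall V W, orth H V W -> orth H W V;
  chhs_transverse : forall V W x, transverse H V W ->
    (exists u r, [/\ proj H W x u, rho H V W r & mdist u r <= A]) \/
    (exists u r, [/\ proj H V x u, rho H W V r & mdist u r <= A]);
  chhs_nested : forall V W x, (V < W)%O ->
    (exists u r, [/\ proj H W x u, rho H V W r & mdist u r <= A]) \/
    (forall u p q, proj H V x u -> proj H W x p -> rhomap H V p q ->
       mdist u q <= A);
  chhs_bgi : forall V W l f (u v : C H W), (V < W)%O ->
    geodesic_segment l f u v ->
    (forall q q', rhomap H V u q -> rhomap H V v q' -> mdist q q' <= A) \/
    (exists t r, [/\ 0 <= t <= l, rho H V W r & mdist (f t) r <= A]);
  chhs_links : forall W x y u v (B : R), proj H W x u -> proj H W y v ->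
    0 <= B -> mdist u v <= B ->
    exists s : seq Dom, [/\ (size s)%:R <= A * B + A,
      forall T, T \in s -> (T < W)%O &
      forall T, (T < W)%O -> (exists2 T', T' \in s & (T <= T')%O) \/
        (exists u' v', [/\ proj H T x u', proj H T y v' & mdist u' v' <= A])];
  chhs_onto : forall W (p : C H W), exists x u, proj H W x u /\ mdist p u <= A;
  chhs_top : exists M, forall V, (V <= M)%O;
  chhs_complexity : exists n, forall s : seq Dom, sorted <%O s -> (size s <= n)%N
}.

End CoarseHHS.

Lemma pigeonhole (T : eqType) (Q : T -> T -> Prop) (Vs cs : seq T) n :
  uniq Vs -> (forall V, V \in Vs -> exists2 c, c \in cs & Q V c) ->
  (size cs * n < size Vs)%N ->
  exists2 c, c \in cs & exists Us, [/\ uniq Us, {subset Us <= Vs},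
    forall V, V \in Us -> Q V c & (n < size Us)%N].
Proof.
elim: cs Vs => [|c cs IHcs] Vs uVs VsQ lt.
  by case: Vs lt VsQ {uVs} => // V Vs _ /(_ V (mem_head _ _))[].
pose Us := [seq V <- Vs | `[< Q V c >]].
have [lt'|ge] := ltnP n (size Us).
  exists c; rewrite ?mem_head//; exists Us; split=> //.
  - exact: filter_uniq.
  - by move=> V; rewrite mem_filter => /andP[].
  - by move=> V; rewrite mem_filter => /andP[/asboolP].
have [|V||c' c'cs [Us' [uUs' sUs' Us'Q ltUs']]] :=
    IHcs [seq V <- Vs | ~~ `[< Q V c >]]; first exact: filter_uniq.
- rewrite mem_filter => /andP[/asboolPn nQ /VsQ[c']].
  by rewrite in_cons => /orP[/eqP->//|]; exists c'.
- have := count_predC (fun V => `[< Q V c >]) Vs.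
  rewrite -!size_filter /= -/Us => e.
  have -> : size [seq V <- Vs | ~~ `[< Q V c >]] = (size Vs - size Us)%N.
    by rewrite -e addKn.
  by move: lt; rewrite /= mulSn; lia.
exists c'; first by rewrite in_cons c'cs orbT.
exists Us'; split=> // V /sUs'; by rewrite mem_filter => /andP[].
Qed.

(** Greedy choice: either something not near the family chosen so far can be added to it, or that
    family covers [Vs]. *)
Lemma separated_or_covered (T : eqType) (near : T -> T -> Prop) (Vs : seq T) m :
  (forall V V', near V V' -> near V' V) -> (forall V, V \in Vs -> near V V) ->
  (exists Us, [/\ uniq Us, {subset Us <= Vs}, size Us = m &
     forall V V', V \in Us -> V' \in Us -> V <> V' -> ~ near V V']) \/
  (exists cs, [/\ {subset cs <= Vs}, (size cs < m)%N &
     forall V, V \in Vs -> exists2 c, c \in cs & near V c]).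
Proof.
move=> nearC nearxx; elim: m => [|m [[Us [uUs sUs Usm sep]]|[cs [scs cm cP]]]].
- by left; exists [::].
- have [cov|] := pselect (forall V, V \in Vs -> exists2 c, c \in Us & near V c).
    by right; exists Us; split=> //; rewrite Usm.
  move=> /existsNP[V /not_implyP[VVs noV]]; left; exists (V :: Us).
  have VUs : V \notin Us.
    by apply/negP => VUs; apply: noV; exists V => //; apply: nearxx.
  split=> //=; rewrite ?VUs ?Usm//.
    by move=> U; rewrite in_cons => /orP[/eqP->|/sUs].
  move=> U U'; rewrite !in_cons => /orP[/eqP->|UU] /orP[/eqP->|UU'] //.
  + by move=> _ nr; apply: noV; exists U'.
  + by move=> _ /nearC nr; apply: noV; exists U.
  exact: sep.
by right; exists cs; split=> //; apply: ltnW.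
Qed.

Section PassingUp.
Context {R : realType} {d : Order.disp_t}.
Context {X : metricType R} {Dom : porderType d}.
Variables (H : hhs_data X Dom) (A : R) (HA : coarse_hhs H A).
Implicit Types (T U V W : Dom) (x y : X) (Vs Us : seq Dom).
Local Notation gp := gromov_product.

Definition far_apart (K : R) V x y : Prop :=
  forall u v, proj H V x u -> proj H V y v -> K <= mdist u v.

(** If consistency puts [rho V W] near [u] or [v], the product is small. Otherwise [rhomap] at [u]
    and [v] recovers the projections to [V], and bounded geodesic image applies to a geodesic from
    [u] to [v]: the two values agree or the geodesic passes near [rho V W]. *)
Lemma gp_rho_or_close V W x y u v r : (V < W)%O ->
  proj H W x u -> proj H W y v -> rho H V W r ->
  gp r u v <= 3 * A \/
  forall u' v', proj H V x u' -> proj H V y v' -> mdist u' v' <= 3 * A.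
Proof.
move=> VW xu yv rr; have A1 := chhs_ge1 HA.
have end_ z w' : proj H W z w' ->
    (exists q s, [/\ proj H W z q, rho H V W s & mdist q s <= A]) ->
    mdist w' r <= 3 * A.
  move=> zw' [q [s [zq rs qs]]].
  have := chhs_proj_diam HA zw' zq; have := chhs_rho_diam HA (or_introl VW) rs rr.
  by have := metric_triangle w' q r; have := metric_triangle q s r; lra.
have [/(end_ _ u xu) ur|nx] := chhs_nested HA x VW.
  by left; apply: le_trans (gp_le_dist _ _ _) ur.
have [/(end_ _ v yv) vr|ny] := chhs_nested HA y VW.
  by left; rewrite gpC; apply: le_trans (gp_le_dist _ _ _) vr.
have [l [f fg]] := chhs_geodesic HA u v.
have [close|[t [s [tl rs ts]]]] := chhs_bgi HA VW fg; last first.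
  left; apply: le_trans (gp_geodesic r fg tl) _; rewrite metric_sym.
  have := chhs_rho_diam HA (or_introl VW) rs rr.
  by have := metric_triangle (f t) s r; lra.
right=> u' v' xu' yv'.
have [q uq] := chhs_rhomap_neq0 HA VW u; have [q' vq'] := chhs_rhomap_neq0 HA VW v.
have := nx _ _ _ xu' xu uq; have := ny _ _ _ yv' yv vq'; have := close _ _ uq vq'.
have := metric_triangle u' q v'; have := metric_triangle q q' v'.
rewrite (metric_sym v' q'); lra.
Qed.

Lemma gp_rho_far V W x y u v r : (V < W)%O -> far_apart (4 * A) V x y ->
  proj H W x u -> proj H W y v -> rho H V W r -> gp r u v <= 3 * A.
Proof.
move=> VW far xu yv rr; have A1 := chhs_ge1 HA.
have [//|close] := gp_rho_or_close VW xu yv rr.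
have [u' xu'] := chhs_proj_neq0 HA V x; have [v' yv'] := chhs_proj_neq0 HA V y.
by have := far u' v' xu' yv'; have := close u' v' xu' yv'; lra.
Qed.

(* [x'] is [x] moved towards [m] in [C H W], up to distance about [rho0]; by
   bounded geodesic image this is invisible in the domains whose [rho] is
   [rho0]-close to [m]. *)
Lemma truncate_towards W x (m : C H W) rho0 : 0 <= rho0 ->
  exists x' w, [/\ proj H W x' w, mdist w m <= rho0 + 6 * A &
    forall V, (V < W)%O -> (forall r, rho H V W r -> mdist m r <= rho0) ->
      forall u v, proj H V x u -> proj H V x' v -> mdist u v <= 3 * A].
Proof.
move=> rho00; have A1 := chhs_ge1 HA; have [u xu] := chhs_proj_neq0 HA W x.
have [near|far] := leP (mdist u m) (rho0 + 5 * A).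
  exists x, u; split=> //; first by lra.
  by move=> V VW _ p q xp xq; have := chhs_proj_diam HA xp xq; lra.
have [l [f fg]] := chhs_geodesic HA u m; have lE := geodesic_length fg.
(* Stopping [rho0 + 5 * A] before [m] makes the product of [u] and [z] based at [rho V W] at least
   [5 * A], hence at least [4 * A] for [w], which rules out the first case of [gp_rho_or_close]. *)
have tl : 0 <= l - (rho0 + 5 * A) <= l by apply/andP; split; lra.
have [e1 e2] := geodesic_split fg tl.
have [x' [w [xw fw]]] := chhs_onto HA (f (l - (rho0 + 5 * A))).
set z := f _ in fw e1 e2.
exists x', w; split=> //.
  by have := metric_triangle w z m; rewrite (metric_sym w z); lra.
move=> V VW rm; have [r rr] := chhs_rho_neq0 HA (or_introl VW).
have [gpr|//] := gp_rho_or_close VW xu xw rr.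
have := rm r rr; have := gp_lip2 r u z w.
have := metric_triangle u r m; have := metric_triangle z r m.
by rewrite (metric_sym r m) [gp r u z]/gromov_product e1; lra.
Qed.

(** Truncation moves both projections to [V] by at most [3 * A], so a [10 * A]-far pair stays more
    than [A] apart, and large links for the truncated points must put [V] below one of its
    domains. *)
Lemma local_links W x y (m : C H W) rho0 (Vs : seq Dom) : 0 <= rho0 ->
  (forall V, V \in Vs -> [/\ (V < W)%O, far_apart (10 * A) V x y &
     forall r, rho H V W r -> mdist m r <= rho0]) ->
  exists s : seq Dom, [/\ (size s)%:R <= A * (2 * rho0 + 12 * A) + A,
    forall T, T \in s -> (T < W)%O &
    forall V, V \in Vs -> exists2 T, T \in s & (V <= T)%O].
Proof.
move=> rho00 VsP; have A1 := chhs_ge1 HA.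
have [x' [u [xu um xP]]] := truncate_towards x m rho00.
have [y' [v [yv vm yP]]] := truncate_towards y m rho00.
have uv : mdist u v <= 2 * rho0 + 12 * A.
  by have := metric_triangle u m v; rewrite (metric_sym m v); lra.
have B0 : 0 <= 2 * rho0 + 12 * A by lra.
have [s [ss sW sP]] := chhs_links HA xu yv B0 uv.
exists s; split=> // V /VsP[VW far close].
have [//|[p [q [xp yq pq]]]] := sP V VW.
have [p' xp'] := chhs_proj_neq0 HA V x; have [q' yq'] := chhs_proj_neq0 HA V y.
have := far _ _ xp' yq'; have := xP V VW close _ _ xp' xp.
have := yP V VW close _ _ yq' yq; have := metric_triangle p' p q'.
by have := metric_triangle p q q'; rewrite (metric_sym q q'); lra.
Qed.

Definition separated_family (sep : R) (m : nat) Vs W Us : Prop :=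
  [/\ uniq Us, {subset Us <= Vs}, size Us = m, forall V, V \in Us -> (V < W)%O &
    forall V V' r r', V \in Us -> V' \in Us -> V <> V' ->
      rho H V W r -> rho H V' W r' -> sep < mdist r r'].

(** The induction on the height of [W] keeps [x] and [y]: the truncated points only serve to find
    [T]. The bound [P] does not depend on [W], as required to apply the induction hypothesis to
    [T]. *)
Lemma passing_up_height (sep : R) (m k : nat) : 0 <= sep ->
  exists P : nat, forall W x y Vs,
    (forall s, path >%O W s -> (size s <= k)%N) ->
    uniq Vs -> (P < size Vs)%N ->
    (forall V, V \in Vs -> (V < W)%O /\ far_apart (10 * A) V x y) ->
    exists W' Us, separated_family sep m Vs W' Us.
Proof.
move=> sep0; have A1 := chhs_ge1 HA; elim: k => [|k [P IHk]].
  exists 0%N => W x y [//|V Vs] chain _ _ VsW.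
  have := chain [:: V]; rewrite /= andbT.
  by have [-> _] := VsW V (mem_head _ _) => /(_ isT).
(* [rho0] adds to [sep] the diameters of the two sets compared; [B] bounds the number of domains
   given by [local_links]. *)
pose rho0 := sep + 2 * A; pose B := Num.trunc (A * (2 * rho0 + 12 * A) + A).
exists (m * (B * P.+1))%N => W x y Vs chain uVs big VsW.
pose near V V' := exists r r', [/\ rho H V W r, rho H V' W r' & mdist r r' <= sep].
have [|V VVs|[Us [uUs sUs Usm Ussep]]|[cs [scs cm cP]]] :=
    @separated_or_covered _ near Vs m.
- by move=> V V' [r [r' [h1 h2 h3]]]; exists r', r; rewrite metric_sym.
- have [VW _] := VsW V VVs; have [r rr] := chhs_rho_neq0 HA (or_introl VW).
  by exists r, r; rewrite mdistxx.
- exists W, Us; split=> // [V /sUs /VsW[]//|V V' r r' VU VU' VV' rr rr'].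
  by rewrite ltNge; apply/negP => le; apply: (Ussep _ _ VU VU' VV'); exists r, r'.
have [|c cc [Us [uUs sUs Usc Usbig]]] := pigeonhole (n := B * P.+1) uVs cP.
  by apply: leq_ltn_trans big; rewrite leq_mul2r ltnW ?orbT.
have [cW _] := VsW c (scs _ cc); have [r0 rr0] := chhs_rho_neq0 HA (or_introl cW).
have rho00 : 0 <= rho0 by rewrite /rho0; lra.
have [|s [ss sW sP]] := local_links (x := x) (y := y) (m := r0) (Vs := Us) rho00.
  move=> V VU; have [VW Vfar] := VsW V (sUs _ VU); split=> // r rr.
  have [r1 [r2 [h1 h2 h3]]] := Usc V VU.
  have := chhs_rho_diam HA (or_introl VW) h1 rr.
  have := chhs_rho_diam HA (or_introl cW) rr0 h2.
  have := metric_triangle r0 r2 r; have := metric_triangle r2 r1 r.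
  by rewrite (metric_sym r2 r1) /rho0; lra.
have sB : (size s <= B)%N.
  by rewrite truncn_ge_nat// addr_ge0 ?mulr_ge0//; rewrite ?addr_ge0 ?mulr_ge0//; lra.
(* [P.+1] instead of [P] leaves room for removing [T], which may itself be among the domains found
   below it. *)
have [|T Ts [Zs [uZs sZs ZT Zbig]]] := pigeonhole (n := P.+1) uUs sP.
  by apply: leq_ltn_trans Usbig; rewrite leq_mul2r sB orbT.
have [||||W' [Us' [h1 h2 h3 h4 h5]]] := IHk T x y (rem T Zs).
- move=> s' ps'; have := chain (T :: s'); rewrite /= ps' sW//=; exact.
- exact: rem_uniq.
- have [TZ|/rem_id->] := boolP (T \in Zs).
    by rewrite size_rem//; case: (size Zs) Zbig.
  exact: ltnW Zbig.
- move=> V; rewrite (mem_rem_uniq T uZs) inE => /andP[VT VZ].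
  have [_ Vfar] := VsW _ (sUs _ (sZs _ VZ)); split=> //.
  by rewrite lt_neqAle VT ZT.
exists W', Us'; split=> // V /h2 /mem_rem /sZs /sUs; exact.
Qed.

Lemma passing_up (sep : R) (m : nat) : 0 <= sep ->
  exists P : nat, forall x y Vs, uniq Vs -> (P < size Vs)%N ->
    (forall V, V \in Vs -> far_apart (10 * A) V x y) ->
    exists W Us, separated_family sep m Vs W Us.
Proof.
move=> sep0; have [M Mtop] := chhs_top HA; have [n chain] := chhs_complexity HA.
have [P PP] := passing_up_height m n sep0; exists P.+1 => x y Vs uVs big VsP.
have [||||W [Us [h1 h2 h3 h4 h5]]] := PP M x y (rem M Vs).
- move=> s ps; have := chain (rev s); rewrite size_rev; apply.
  by rewrite rev_sorted; apply: path_sorted ps.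
- exact: rem_uniq.
- have [MV|/rem_id->] := boolP (M \in Vs).
    by rewrite size_rem//; case: (size Vs) big.
  exact: ltnW big.
- move=> V; rewrite (mem_rem_uniq M uVs) inE => /andP[VM /VsP far]; split=> //.
  by rewrite lt_neqAle VM Mtop.
exists W, Us; split=> // V /h2 /mem_rem; exact.
Qed.

End PassingUp.

(** * From the axioms to a single constant *)

Section FromHHS.
Context {R : realType} {d : Order.disp_t}.
Context {X : metricType R} {Dom : porderType d}.
Implicit Types (H : hhs_data X Dom) (T U V W : Dom) (x y : X).

(** The nesting axiom gives a unique maximal element; it is the greatest one because, by finite
    complexity, every domain lies below a maximal one. *)
Lemma hhs_top H c : is_hhs H c -> exists M, forall V, (V <= M)%O.
Proof.
move=> HH; have [[M [_ Muniq]] _ _] := hhs_nestingP HH.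
exists M => V; suff [M' [VM' maxM']] : exists M' : Dom, (V <= M')%O /\
    forall U, (M' <= U)%O -> U = M'.
  by rewrite (Muniq M' maxM').
have chain (s : seq Dom) : path <%O V s -> (size s <= c_n c)%N.
  by move=> Vs; apply: (hhs_finite_complexityP HH); apply: path_sorted Vs.
elim: (c_n c) V chain => [|k IHk] V chain.
  exists V; split=> // U VU; apply/eqP; case: (eqVneq U V) => // UV.
  by have := chain [:: U]; rewrite /= lt_neqAle eq_sym UV VU => /(_ isT).
have [maxV|] := pselect (forall U, (V <= U)%O -> U = V); first by exists V.
move=> /existsNP[U /not_implyP[VU /eqP UV]].
have VU' : (V < U)%O by rewrite lt_neqAle eq_sym UV.
have [|M' [UM' maxM']] := IHk U.
  by move=> s Us; have := chain (U :: s); rewrite /= VU' Us; exact.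
by exists M'; split=> //; apply: le_trans UM'.
Qed.

(** The sum strictly exceeds the structure constants, so that bounds on infimal distances yield
    actual points at distance at most [A]; [5 + 3 * |delta|] covers the constants of
    [slim_four_point] and [slim_near_geodesic]. *)
Lemma coarse_hhs_of_hhs H c : is_hhs H c ->
  exists A0, forall A, A0 <= A -> coarse_hhs H A.
Proof.
move=> HH.
exists (5 + 3 * `|c_delta c| + `|c_E c| + `|c_xi c| + `|c_kappa0 c| + `|c_K c|
        + `|c_lambda c|) => A AA.
have hd := ler_norm (c_delta c); have hd0 := normr_ge0 (c_delta c).
have hE := ler_norm (c_E c); have hE0 := normr_ge0 (c_E c).
have hx := ler_norm (c_xi c); have hx0 := normr_ge0 (c_xi c).
have hk := ler_norm (c_kappa0 c); have hk0 := normr_ge0 (c_kappa0 c).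
have hK := ler_norm (c_K c); have hK0 := normr_ge0 (c_K c).
have hl := ler_norm (c_lambda c); have hl0 := normr_ge0 (c_lambda c).
have hyp := hhs_hyperbolicP HH.
have [pne pdiam _ _] := hhs_projectionsP HH.
have [_ rho1 rhomap1] := hhs_nestingP HH.
have [orthC _ _ _ _] := hhs_orthogonalityP HH.
have [rho2 trans nest _] := hhs_consistencyP HH.
have [l1 _ _ links] := hhs_large_linksP HH.
have kA : c_kappa0 c < A by lra.
have EA : c_E c < A by lra.
have KA : c_K c < A by lra.
split=> //.
- by lra.
- move=> W p x y z r h1 h2; have := slim_four_point (hyp W) h1 h2; lra.
- by move=> W; have [] := hyp W.
- move=> W p l f u v fg; have [t tl] := slim_near_geodesic p (hyp W) fg.
  by exists t => //; lra.
- by move=> W x u v xu xv; have := diam_ub (pdiam W x) xu xv; lra.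
- by move=> V W [/rho1[]|/rho2[]].
- move=> V W u v VW ru rv.
  have : (diam (rho H V W) <= (c_xi c)%:E)%E by case: VW => [/rho1[]|/rho2[]].
  by move=> /diam_ub /(_ ru rv); lra.
- move=> V W x VW; have := trans V W x VW; rewrite ge_min => /orP[] /setdist_lt /(_ kA).
    by move=> [u [r [h1 h2 h3]]]; left; exists u, r; split=> //; apply: ltW.
  by move=> [u [r [h1 h2 h3]]]; right; exists u, r; split=> //; apply: ltW.
- move=> V W x VW; have := nest V W x VW; rewrite ge_min => /orP[/setdist_lt /(_ kA)|dm].
    by move=> [u [r [h1 h2 h3]]]; left; exists u, r; split=> //; apply: ltW.
  right=> u p q xu xp pq; suff : mdist u q <= c_kappa0 c by lra.
  by apply: diam_ub dm _ _; [left|right; exists p].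
- move=> V W l f u v VW fg; have [l0 f_geo f0 fl] := fg.
  have [dm|[t tl]] := hhs_bounded_geodesic_imageP HH VW
      (@interval_is_interval _ `[0, l]) f_geo.
    left=> q q' uq vq'; suff : mdist q q' <= c_E c by lra.
    apply: diam_ub dm _ _; [exists 0|exists l]; rewrite ?f0 ?fl//=;
      by rewrite in_itv/= lexx l0.
  move=> /setdist_lt /(_ EA)[_ [r [-> rr tr]]].
  by right; exists t, r; split=> //; apply: ltW.
- move=> W x y u v B xu yv B0 uv; have [s [ss sW sP]] := links W x y.
  have sd := setdist_le xu yv uv.
  exists s; split.
  + rewrite -lee_fin; apply: le_trans ss _; rewrite EFinD EFinM.
    apply: leeD; last by rewrite lee_fin; lra.
    apply: (@le_trans _ _ ((c_lambda c)%:E * B%:E)%E).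
      by apply: lee_wpmul2l sd; rewrite lee_fin; lra.
    by rewrite -!EFinM lee_fin ler_wpM2r//; lra.
  + by move=> T /sW[].
  move=> T /sP[|/ltW /setdist_lt /(_ EA)]; first by left.
  by move=> [u' [v' [h1 h2 h3]]]; right; exists u', v'; split=> //; apply: ltW.
- move=> W p; have := hhs_normalizedP HH p.
  move=> /setdist_lt /(_ KA)[_ [u [-> [x _ xu] pu]]].
  by exists x, u; split=> //; apply: ltW.
- exact: hhs_top HH.
- by exists (c_n c); exact: hhs_finite_complexityP HH.
Qed.

End FromHHS.

(** * Projections of hierarchy rays *)

Lemma unparam_coarse_ray (R : realType) (M : metricType R) (L K A : R)
    (F : R -> set M) : 1 <= L -> 0 <= K -> L + 2 * K <= A ->
  (forall t, F t !=set0) -> (forall t u v, F t u -> F t v -> mdist u v <= K) ->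
  unparam_quasigeodesic L `[0, +oo[ F -> coarse_ray A F.
Proof.
move=> L1 K0 LA Fne FK [phi [mono itv qi]].
have in0 (t : R) : 0 <= t -> `[0, +oo[%classic t by rewrite /= in_itv/= andbT.
exists phi; split=> //.
- by move=> s t s0 st; apply: mono => //; apply: in0 => //; apply: le_trans st.
- move=> s t r s0 t0 sr.
  have [||r'] := itv (phi s) (phi t) _ _ r sr.
  - by exists s => //; exact: in0.
  - by exists t => //; exact: in0.
  by rewrite /= in_itv/= andbT => r0 <-; exists r'.
move=> s t u v s0 t0 Fu Fv; have /andP[lo hi] := qi s t (in0 _ s0) (in0 _ t0).
have LA' : A^-1 <= L^-1 by rewrite lef_pV2 ?posrE; lra.
have nn : 0 <= `|phi s - phi t| by [].
apply/andP; split.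
  have : (diam (F s `|` F t) <= (mdist u v + 2 * K)%:E)%E.
    have uv0 := mdist_ge0 u v.
    apply: diam_le => [|p q [Fp|Fp] [Fq|Fq]]; first by lra.
    - by have := FK _ _ _ Fp Fq; lra.
    - have := FK _ _ _ Fp Fu; have := FK _ _ _ Fv Fq.
      by have := metric_triangle p u q; have := metric_triangle u v q; lra.
    - have := FK _ _ _ Fp Fv; have := FK _ _ _ Fu Fq.
      have := metric_triangle p v q; have := metric_triangle v u q.
      by rewrite (metric_sym v u); lra.
    by have := FK _ _ _ Fp Fq; lra.
  move=> /(le_trans lo); rewrite lee_fin.
  have : A^-1 * `|phi s - phi t| <= L^-1 * `|phi s - phi t| by apply: ler_wpM2r.
  lra.
have := diam_ub hi (or_introl Fu) (or_intror Fv).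
have : L * `|phi s - phi t| <= A * `|phi s - phi t| by apply: ler_wpM2r => //; lra.
lra.
Qed.

(* Up to the error [D], [c] is the limit of [F t] as [t] tends to [+oo]. *)
Definition approximates (R : realType) (M : metricType R) (D : R)
    (c : endpoint M) (F : R -> set M) : Prop :=
  match c with
  | Inside B => B !=set0 /\ forall q, B q -> exists T, forall t v, T <= t ->
      F t v -> mdist q v <= D
  | AtInfinity b => tends_to F b
  end.

Section RayProjection.
Context {R : realType} {d : Order.disp_t}.
Context {X : metricType R} {Dom : porderType d}.
Variables (H : hhs_data X Dom) (c : hhs_constants R) (A A' L : R).
Hypotheses (HA : coarse_hhs H A) (hyp : hhs_hyperbolic H c).
Hypotheses (L1 : 1 <= L) (LA : L + 2 * A <= A').
Implicit Types (U V W : Dom) (h : R -> X) (E N B T : R).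
Local Notation gp := gromov_product.

Lemma Xray_coarse_ray h U : Xray H L h -> coarse_ray A' (fun t => proj H U (h t)).
Proof.
move=> [_ [_ /(_ U)]]; have A1 := chhs_ge1 HA; apply: (unparam_coarse_ray (K := A)) => //.
- by lra.
- by move=> t; apply: chhs_proj_neq0 HA _ _.
by move=> t u v; apply: chhs_proj_diam HA _ _ _ _.
Qed.

Lemma supp_tends_to h U : Xray H L h -> supp H h U ->
  tends_to (fun t => proj H U (h t)) (ray_limit H h U).
Proof.
move=> hX hU; have A1 := chhs_ge1 HA; have L1' := L1; have LA' := LA.
(* [ray_limit] is a default value unless some limit exists, so existence has to be supplied. *)
apply: (xgetPex set0 (P := tends_to (fun t => proj H U (h t)))).
have A0 : 0 <= A by lra.
have A1' : 1 <= A' by lra.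
exact: (coarse_ray_tends_to (chhs_four_point HA (W := U)) (chhs_geodesic HA (W := U))
  A0 A1' (Xray_coarse_ray U hX) hU).
Qed.

Lemma supp_escape h U q B : Xray H L h -> supp H h U ->
  exists2 T, 0 <= T & forall t u, T <= t -> proj H U (h t) u -> B <= mdist q u.
Proof.
move=> hX hU; have A1 := chhs_ge1 HA; have L1' := L1; have LA' := LA.
have A1' : 1 <= A' by lra.
exact: (coarse_ray_escape A1' (Xray_coarse_ray U hX) hU q B).
Qed.

Lemma supp_proj_far h U (q : C H U) B : Xray H L h -> supp H h U ->
  exists2 T, 0 <= T & forall t u v, T <= t -> proj H U (h t) u ->
    mdist q v <= A -> B < mdist u v.
Proof.
move=> hX hU; have [T T0 TB] := supp_escape q (B + A + 1) hX hU.
exists T => // t u v Tt tu qv; have := TB t u Tt tu.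
have := metric_triangle q v u; rewrite (metric_sym v u); lra.
Qed.

(** Seen from [rho V W], the point [z] and the projection of a late [h t] have a large product, so a
    geodesic between them avoids [rho V W] and [rhomap] hardly changes along it. The time depends on
    the ray through [z], which is why [approximates] lets it depend on the point [q]. *)
Lemma nested_in_supp_approx E N h V W q : 0 <= N -> 3 * A + 1 + 30 * c_delta c <= E ->
  Xray H L h -> supp H h W -> (V < W)%O ->
  (exists2 z, far_points H c E N h V W z & rhomap H V z q) ->
  exists T, forall t v, T <= t -> proj H V (h t) v -> mdist q v <= 2 * A.
Proof.
move=> N0 EA hX hW VW [z [g [t [[gq g0] glim t0 zE zfar]]] zq].
have A1 := chhs_ge1 HA; have [d0 _ _] := hyp W.
have zfar' : E + N <= mdist z (g 0).
  by rewrite -lee_fin; apply: le_trans zfar (setdist_le _ g0 (lexx _)).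
have in0 (s : R) : 0 <= s -> `[0, +oo[%classic s by rewrite /= in_itv/= andbT.
have [T1 T1P] := tends_to_gp (chhs_four_point HA (W := W)) glim
  (supp_tends_to hX hW) (g 0) (3 * A + 1).
have [T2 T20 T2P] := supp_proj_far (g 0) A hX hW.
exists (Num.max T1 T2) => t' v; rewrite ge_max => /andP[T1t T2t] tv.
have [w tw] := chhs_proj_neq0 HA W (h t').
pose s := Num.max T1 t.
have T1s : T1 <= s by rewrite le_max lexx.
have ts : t <= s by rewrite le_max lexx orbT.
have s0 : 0 <= s by apply: le_trans ts.
(* The quasigeodesic error [20 * delta] enters three times and is halved in the product: this is the
   [30 * delta] in the bound on [E]. *)
have zs : 3 * A + 1 <= gp (g 0) z (g s).
  have /andP[h1 _] := gq s 0 (in0 _ s0) (in0 _ (lexx 0)).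
  have /andP[_ h2] := gq t s (in0 _ t0) (in0 _ s0).
  have /andP[_ h3] := gq t 0 (in0 _ t0) (in0 _ (lexx 0)).
  rewrite invr1 !mul1r !subr0 (ger0_norm s0) in h1.
  rewrite mul1r distrC ger0_norm ?subr_ge0// in h2.
  rewrite mul1r subr0 (ger0_norm t0) in h3.
  by rewrite /gromov_product zE in zfar' *; lra.
have sw := T1P s t' (g s) w T1s T1t erefl tw.
have zw := chhs_four_point HA zs sw.
have [l [f fg]] := chhs_geodesic HA z w.
have [close|[r [p [rl rp pr]]]] := chhs_bgi HA VW fg; last first.
  have := gp_geodesic (g 0) fg rl; have := chhs_rho_diam HA (or_introl VW) g0 rp.
  by have := metric_triangle (g 0) p (f r); rewrite (metric_sym p (f r)); lra.
have [q' wq'] := chhs_rhomap_neq0 HA VW w.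
have [[w' [r [tw' rr wr]]]|close'] := chhs_nested HA (h t') VW.
  have := T2P t' w' r T2t tw' (chhs_rho_diam HA (or_introl VW) g0 rr); lra.
have := close _ _ zq wq'; have := close' _ _ _ tv tw wq'.
by have := metric_triangle q q' v; rewrite (metric_sym q' v); lra.
Qed.

(** The set [Y] is nonempty only if some ray leads from [rho V W] to the limit; [boundary_ray]
    provides one. *)
Lemma far_points_rhomap_neq0 E N h V W : Xray H L h -> supp H h W -> (V < W)%O ->
  exists q z, far_points H c E N h V W z /\ rhomap H V z q.
Proof.
move=> hX hW VW; have A1 := chhs_ge1 HA; have [d0 _ _] := hyp W.
have [p rp] := chhs_rho_neq0 HA (or_introl VW).
have glim := supp_tends_to hX hW; have [bb _] := glim.
have [g [gq g0 gb]] := boundary_ray (hyp W) p bb.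
have in0 (s : R) : 0 <= s -> `[0, +oo[%classic s by rewrite /= in_itv/= andbT.
pose t := `|E| + `|N| + A + 2 * c_delta c.
have En := ler_norm E; have Nn := ler_norm N.
have E0 := normr_ge0 E; have Nn0 := normr_ge0 N.
have t0 : 0 <= t by rewrite /t; lra.
have [q zq] := chhs_rhomap_neq0 HA VW (g t).
exists q, (g t); split=> //; exists g, t; split=> //; first split.
- move=> s s' sI s'I; have := gq s s' sI s'I; rewrite invr1 !mul1r => /andP[h1 h2].
  by apply/andP; split; lra.
- by rewrite g0.
apply: le_ereal_inf_tmp => _ [[z r] [/= -> rr] <-]; rewrite lee_fin.
have /andP[h1 _] := gq t 0 (in0 _ t0) (in0 _ (lexx 0)).
rewrite invr1 !mul1r !subr0 (ger0_norm t0) g0 in h1.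
have := chhs_rho_diam HA (or_introl VW) rr rp; have := metric_triangle (g t) r p.
by rewrite /t in h1; lra.
Qed.

(** The projection to [W] leaves every neighborhood of [rho V W], so consistency can only hold in
    [V]. *)
Lemma transverse_supp_approx h V W q : Xray H L h -> supp H h W ->
  transverse H W V -> rho H W V q ->
  exists T, forall t v, T <= t -> proj H V (h t) v -> mdist q v <= 3 * A.
Proof.
move=> hX hW tWV rq; have A1 := chhs_ge1 HA.
have tVW : transverse H V W.
  by have [h1 h2] := tWV; split; [move=> /(chhs_orthC HA)|rewrite comparable_sym].
have [r0 rr0] := chhs_rho_neq0 HA (or_intror tVW).
have [T T0 TP] := supp_proj_far r0 A hX hW.
exists T => t v Tt tv.
have [[u [r [tu rr ur]]]|[u [r [tu rr ur]]]] := chhs_transverse HA (h t) tWV.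
  have := chhs_proj_diam HA tu tv; have := chhs_rho_diam HA (or_intror tWV) rq rr.
  have := metric_triangle q r v; have := metric_triangle r u v.
  by rewrite (metric_sym r u); lra.
have := TP t u r Tt tu (chhs_rho_diam HA (or_intror tVW) rr0 rr); lra.
Qed.

(** In [V] the projections [v] and [v'] at two late times are [2 * A']-close, while in [W] the same
    two times can be made far apart. So [rho W V] is near a geodesic from [v] to [v'], hence near
    [v]. *)
Lemma supp_nested_approx h V W q : Xray H L h -> supp H h W -> ~ supp H h V ->
  (W < V)%O -> rho H W V q ->
  exists T, forall t v, T <= t -> proj H V (h t) v -> mdist q v <= 3 * A + 2 * A'.
Proof.
move=> hX hW hV WV rq; have A1 := chhs_ge1 HA; have L1' := L1; have LA' := LA.
have A1' : 1 <= A' by lra.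
have [T T0 TP] := coarse_ray_stabilizes A1' (Xray_coarse_ray V hX) hV.
exists T => t v Tt tv; have [w tw] := chhs_proj_neq0 HA W (h t).
have [T' T'0 T'P] := supp_escape w (3 * A + 1) hX hW.
pose s := Num.max T T'.
have Ts : T <= s by rewrite le_max lexx.
have T's : T' <= s by rewrite le_max lexx orbT.
have [w' sw'] := chhs_proj_neq0 HA W (h s); have [v' sv'] := chhs_proj_neq0 HA V (h s).
have vv' := TP t s v v' Tt Ts tv sv'.
have [gq|close] := gp_rho_or_close HA WV tv sv' rq; last first.
  by have := close _ _ tw sw'; have := T'P s w' T's sw'; lra.
move: gq; rewrite /gromov_product; have := metric_triangle q v' v.
rewrite (metric_sym q v) (metric_sym q v') (metric_sym v' v).
have := metric_triangle v v' q; lra.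
Qed.

(** [D0] comes before [E], [N] and [tau], which lets the final threshold for [E] depend on it. *)
Lemma ray_proj_approx : exists D0 : R, [/\ 3 * A + 2 * A' <= D0 &
  forall E N tau, 0 <= N -> 3 * A + 1 + 30 * c_delta c <= E -> time_choice H L tau ->
  forall h U, Xray H L h ->
    approximates D0 (ray_proj H c E N tau h U) (fun t => proj H U (h t))].
Proof.
have A1 := chhs_ge1 HA; have L1' := L1; have LA' := LA.
have A0 : 0 <= A by lra.
have A1' : 1 <= A' by lra.
have [Dm Dm0 DmP] := coarse_ray_morse A0 A1'.
exists (3 * A + 2 * A' + 2 * Dm + 2 * A + 1); split; first by lra.
move=> E N tau N0 EA tauP h U hX; rewrite /ray_proj.
case: asboolP => [hU|hU]; first exact: supp_tends_to.
case: asboolP => [[W0 hW0 UW0]|noW].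
  split.
    have [q [z [zf zq]]] := far_points_rhomap_neq0 E N hX hW0 UW0.
    by exists q, W0 => //; exists z.
  move=> q [W [hW UW] [z zf zq]].
  have [|T TP] := nested_in_supp_approx (q := q) N0 EA hX hW UW; first by exists z.
  by exists T => t v Tt tv; have := TP t v Tt tv; lra.
case: asboolP => [orthU|northU].
  have [tau0 tauU] := tauP h U hX orthU.
  split; first exact: chhs_proj_neq0 HA _ _.
  move=> q tq; exists (tau h U) => t v tt tv.
  have [u0 hu0] := chhs_proj_neq0 HA U (h 0).
  (* By the Morse property [q] almost lies between [u0] and [v], and by the choice of [tau] the
     point [v] is hardly farther from [u0] than [q] is; hence [v] is close to [q]. *)
  have m := DmP _ _ (chhs_four_point HA (W := U)) (chhs_geodesic HA (W := U))
    (Xray_coarse_ray U hX) 0 (tau h U) t u0 q v (lexx 0) tau0 tt hu0 tq tv.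
  have far : mdist u0 v <= mdist u0 q + 2 * A + 1.
    have t0 := le_trans tau0 tt.
    rewrite -lee_fin; apply: le_trans (le_diam _ _ (lexx _)) _; last first.
      apply: le_trans (tauU t t0) _; rewrite EFinD; apply: leeD => //.
      apply: diam_le => [|a b [ha|ha] [hb|hb]].
      - by have := mdist_ge0 u0 q; lra.
      - have := chhs_proj_diam HA ha hb; have := mdist_ge0 u0 q; lra.
      - have := chhs_proj_diam HA ha hu0; have := chhs_proj_diam HA tq hb.
        by have := metric_triangle a u0 b; have := metric_triangle u0 q b; lra.
      - have := chhs_proj_diam HA ha tq; have := chhs_proj_diam HA hu0 hb.
        have := metric_triangle a q b; have := metric_triangle q u0 b.
        by rewrite (metric_sym q u0); lra.
      have := chhs_proj_diam HA ha hb; have := mdist_ge0 u0 q; lra.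
    - by right.
    by left.
  by move: m; rewrite /gromov_product (metric_sym v q); lra.
split.
  move: northU => /existsNP[W /not_implyP[hW nUW]].
  have nWU : ~ orth H W U by move=> /(chhs_orthC HA).
  have [cWU|nc] := boolP (W >=< U)%O.
    have WU : (W < U)%O.
      rewrite lt_neqAle; apply/andP; split; first by apply: contra_notN hU => /eqP <-.
      case/orP: cWU => // UW; exfalso; apply: noW; exists W => //.
      by rewrite lt_neqAle UW andbT; apply: contra_notN hU => /eqP ->.
    by have [r rr] := chhs_rho_neq0 HA (or_introl WU); exists r, W => //; split=> //; right.
  have tWU : transverse H W U by [].
  by have [r rr] := chhs_rho_neq0 HA (or_intror tWU); exists r, W => //; split=> //; left.
move=> q [W [hW [tWU|WU]] rq].
  have [T TP] := transverse_supp_approx hX hW tWU rq.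
  by exists T => t v Tt tv; have := TP t v Tt tv; lra.
have [T TP] := supp_nested_approx hX hW hU WU rq.
by exists T => t v Tt tv; have := TP t v Tt tv; lra.
Qed.

End RayProjection.

(** * Distances and geodesics between approximated end points *)

Section Approximation.
Context {R : realType} {M : metricType R}.
Variables (A : R) (four : four_point M A) (geo : geodesic_space (M := M)).
Hypothesis near : forall (p : M) l f u v, geodesic_segment l f u v ->
  exists2 t, 0 <= t <= l & mdist p (f t) <= gromov_product p u v + A.
Variables (D : R) (D0 : 0 <= D) (F F' : R -> set M) (c c' : endpoint M).
Hypotheses (Fne : forall t, F t !=set0) (F'ne : forall t, F' t !=set0).
Hypotheses (cF : approximates D c F) (cF' : approximates D c' F').
Local Notation gp := (@gromov_product R M).
Implicit Types (K C T : R).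

(** The diameter of the union may come from two points of the same set; these are [2 * D]-close and
    the bound claimed is then negative. The 1 is lost because the supremum need not be attained. *)
Lemma approximates_far K : (K%:E <= endpoint_dist c c')%E ->
  exists T, forall t u v, T <= t -> F t u -> F' t v -> K - 1 - 2 * D <= mdist u v.
Proof.
have D0' := D0.
have self (B : set M) (G : R -> set M) :
    approximates D (Inside B) G -> (forall t, G t !=set0) ->
    forall a b, B a -> B b -> mdist a b <= 2 * D.
  move=> [_ BP] Gne a b Ba Bb; have [T TP] := BP a Ba; have [T' TP'] := BP b Bb.
  have [u Gu] := Gne (Num.max T T').
  have := TP _ u _ Gu; have := TP' _ u _ Gu; rewrite !le_max !lexx orbT.
  move=> /(_ isT) h1 /(_ isT) h2; have := metric_triangle a u b.
  by rewrite (metric_sym u b); lra.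
case: c c' cF cF' => [B|b] [B'|b'] /= cB cB' KE.
- have [K1|K1] := leP K 1.
    by exists 0 => t u v _ _ _; have := mdist_ge0 u v; lra.
  have [||p [q [pB qB pq]]] := @diam_gt _ _ (B `|` B') (K - 1); first by lra.
    by apply: lt_le_trans KE; rewrite lte_fin; lra.
  have trivial_ : mdist p q <= 2 * D -> exists T, forall t u v, T <= t ->
      F t u -> F' t v -> K - 1 - 2 * D <= mdist u v.
    by exists 0 => t u v _ _ _; have := mdist_ge0 u v; lra.
  have cross p' q' : B p' -> B' q' -> K - 1 < mdist p' q' -> exists T, forall t u v,
      T <= t -> F t u -> F' t v -> K - 1 - 2 * D <= mdist u v.
    move=> Bp Bq pq'; have [T TP] := cB.2 p' Bp; have [T' TP'] := cB'.2 q' Bq.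
    exists (Num.max T T') => t u v; rewrite ge_max => /andP[Tt T't] Fu Fv.
    have := TP t u Tt Fu; have := TP' t v T't Fv.
    have := metric_triangle p' u q'; have := metric_triangle u v q'.
    by rewrite (metric_sym v q'); lra.
  case: pB qB => [Bp|Bp] [Bq|Bq].
  + exact: (trivial_ (self B F cB Fne _ _ Bp Bq)).
  + exact: cross Bp Bq pq.
  + by apply: cross Bq Bp _; rewrite metric_sym.
  exact: (trivial_ (self B' F' cB' F'ne _ _ Bp Bq)).
- have [[q Bq] BP] := cB; have [T TP] := BP q Bq.
  have [T' TP'] := tends_to_escape four q (K + D) cB'.
  exists (Num.max T T') => t u v; rewrite ge_max => /andP[Tt T't] Fu Fv.
  have := TP t u Tt Fu; have := TP' t v T't Fv; have := metric_triangle q u v; lra.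
- have [[q Bq] BP] := cB'; have [T TP] := BP q Bq.
  have [T' TP'] := tends_to_escape four q (K + D) cB.
  exists (Num.max T T') => t u v; rewrite ge_max => /andP[Tt T't] Fu Fv.
  have := TP t v Tt Fv; have := TP' t u T't Fu; have := metric_triangle q v u.
  by rewrite (metric_sym v u); lra.
case: asboolP KE => [_|nb _].
  by rewrite lee_fin => K0; exists 0 => t u v _ _ _; have := mdist_ge0 u v; lra.
have [T TP] := tends_to_far four (K - 1 - 2 * D) cB cB' nb.
by exists T => t u v Tt Fu Fv; apply: (TP t t u v).
Qed.

(** Small products put [r] and [r'] near a common geodesic from a point of [B] to one of [B'], which
    is therefore long. Equal boundary points are excluded, as products at [r] would diverge. *)
Lemma approximates_dist C K r r' :
  (exists T, forall t u v, T <= t -> F t u -> F' t v ->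
     gp r u v <= C /\ gp r' u v <= C) ->
  K + 2 * (C + 2 * D + A) <= mdist r r' -> (K%:E <= endpoint_dist c c')%E.
Proof.
move=> [T TP] rr'; case: c c' cF cF' => [B|b] [B'|b'] /= cB cB'; rewrite ?leey//.
  have [[q Bq] BP] := cB; have [[q' Bq'] BP'] := cB'.
  have [T1 TP1] := BP q Bq; have [T2 TP2] := BP' q' Bq'.
  pose t := Num.max T (Num.max T1 T2).
  have [u Fu] := Fne t; have [v Fv] := F'ne t.
  have qu : mdist q u <= D by apply: TP1 Fu; rewrite !le_max lexx orbT.
  have qv : mdist q' v <= D by apply: TP2 Fv; rewrite !le_max lexx !orbT.
  have [g1 g2] : gp r u v <= C /\ gp r' u v <= C by apply: TP Fu Fv; rewrite le_max lexx.
  have [l [f fg]] := geo q q'; have lE := geodesic_length fg.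
  have [t1 /andP[t1l t1u] h1] := near r fg; have [t2 /andP[t2l t2u] h2] := near r' fg.
  have gq s : gp s u v <= C -> gp s q q' <= C + 2 * D.
    by have := gp_lip s q u q'; have := gp_lip2 s u q' v; lra.
  have e : mdist (f t1) (f t2) <= l.
    have [l0 fgeo _ _] := fg; rewrite fgeo/= ?in_itv/= ?t1l ?t2l//.
    by rewrite ler_norml; lra.
  have : K <= mdist q q'.
    have := gq _ g1; have := gq _ g2; have := metric_triangle r (f t1) r'.
    have := metric_triangle (f t1) (f t2) r'; rewrite (metric_sym (f t2) r'); lra.
  by apply: le_diam; [left|right].
case: asboolP => [e|_]; last exact: leey.
exfalso; rewrite -e in cB'.
have [T1 TP1] := tends_to_gp four cB cB' r (C + 1).
pose t := Num.max T T1; have [u Fu] := Fne t; have [v Fv] := F'ne t.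
have Tt : T <= t by rewrite le_max lexx.
have T1t : T1 <= t by rewrite le_max lexx orbT.
by have := TP1 t t u v T1t T1t Fu Fv; have [] := TP t u v Tt Fu Fv; lra.
Qed.

Lemma tends_to_gp_transfer (G : R -> set M) b r C : tends_to G b -> tends_to F b ->
  exists T, forall s t w u v, T <= s -> T <= t -> G s w -> F t u ->
    gp r u v <= C -> gp r w v <= C + A.
Proof.
move=> Gb Fb; have [T TP] := tends_to_gp four Fb Gb r (C + A + 1).
exists T => s t w u v Ts Tt Gw Fu uv; rewrite leNgt; apply/negP => lt.
have := TP t s u w Tt Ts Fu Gw => uw.
(* [four_point] takes one common lower bound, so [gp r w v] is cut off at [C + A + 1]. *)
have le1 : Num.min (gp r w v) (C + A + 1) <= gp r u w.
  by apply: le_trans uw; rewrite ge_min lexx orbT.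
have le2 : Num.min (gp r w v) (C + A + 1) <= gp r w v by rewrite ge_min lexx.
have := four le1 le2; have : C + A < Num.min (gp r w v) (C + A + 1).
  by rewrite lt_min lt; lra.
lra.
Qed.

End Approximation.

Section GeodesicBetween.
Context {R : realType} {M : metricType R}.
Variables (A : R) (four : four_point M A) (A0 : 0 <= A) (D : R) (D0 : 0 <= D).
Hypothesis near : forall (p : M) l f u v, geodesic_segment l f u v ->
  exists2 t, 0 <= t <= l & mdist p (f t) <= gromov_product p u v + A.
Local Notation gp := (@gromov_product R M).
Implicit Types (F : R -> set M) (c : endpoint M) (a b : \bar R) (g : R -> M).

(** [u] is replaced by a point of the geodesic: its start if this is finite, at cost [D], and
    otherwise a point far out on it, at cost [A]. *)
Lemma start_transfer F c a b g r C : approximates D c F -> (a <= b)%E ->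
  b != -oo%E -> starts_at g a c ->
  exists2 s, domain a b s & exists T, forall t u v, T <= t -> F t u ->
    gp r u v <= C -> gp r (g s) v <= C + D + A.
Proof.
have A0' := A0; have D0' := D0.
case: a c => [a||] [B|p] //= cF ab bn gs.
  exists a; first by split.
  have [T TP] := cF.2 _ gs; exists T => t u v Tt Fu uv.
  by have := TP t u Tt Fu; have := gp_lip r (g a) u v; lra.
have [T TP] := tends_to_gp_transfer four r C gs cF.
have [s0 s0b] : exists s0, (s0%:E <= b)%E.
  by case: b bn {ab} => [b _|_|//]; [exists b|exists 0; rewrite leey].
have sT : T <= - Num.min s0 (- T) by rewrite lerNr ge_min lexx orbT.
exists (Num.min s0 (- T)).
  split; first by rewrite leNye.
  by apply: le_trans s0b; rewrite lee_fin ge_min lexx.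
exists T => t u v Tt Fu uv.
have := TP _ _ _ u v sT Tt erefl Fu uv; rewrite opprK; lra.
Qed.

Lemma stop_transfer F c a b g r C : approximates D c F -> (a <= b)%E ->
  a != +oo%E -> stops_at g b c ->
  exists2 s, domain a b s & exists T, forall t u v, T <= t -> F t u ->
    gp r u v <= C -> gp r (g s) v <= C + D + A.
Proof.
have A0' := A0; have D0' := D0.
case: b c => [b||] [B|p] //= cF ab an gs.
  exists b; first by split.
  have [T TP] := cF.2 _ gs; exists T => t u v Tt Fu uv.
  by have := TP t u Tt Fu; have := gp_lip r (g b) u v; lra.
have [T TP] := tends_to_gp_transfer four r C gs cF.
have [s0 s0a] : exists s0, (a <= s0%:E)%E.
  by case: a an {ab} => [a _|//|_]; [exists a|exists 0; rewrite leNye].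
have sT : T <= Num.max s0 T by rewrite le_max lexx orbT.
exists (Num.max s0 T).
  split; last by rewrite leey.
  by apply: le_trans s0a _; rewrite lee_fin le_max lexx.
by exists T => t u v Tt Fu uv; have := TP _ _ _ u v sT Tt erefl Fu uv; lra.
Qed.

(** Once both ends are replaced by points of [g], [near] applies to the segment between them. The
    two parameters are found independently, so they may come in either order. *)
Lemma near_geodesic_between F F' c c' a b g r C :
  (forall t, F t !=set0) -> (forall t, F' t !=set0) ->
  approximates D c F -> approximates D c' F' -> geodesic_between a b g c c' ->
  (exists T, forall t u v, T <= t -> F t u -> F' t v -> gp r u v <= C) ->
  exists2 s, domain a b s & mdist r (g s) <= C + 2 * D + 3 * A.
Proof.
move=> Fne F'ne cF cF' [ab geo ga gb] [T TP].
have an : a != +oo%E by case: (a) ga.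
have bn : b != -oo%E by case: (b) gb.
have [s1 s1I [T1 TP1]] := start_transfer r C cF ab bn ga.
have [s2 s2I [T2 TP2]] := stop_transfer r (C + D + A) cF' ab an gb.
pose t := Num.max T (Num.max T1 T2).
have [u Fu] := Fne t; have [v Fv] := F'ne t.
have e1 : gp r (g s1) v <= C + D + A.
  apply: (TP1 t u v _ Fu); first by rewrite !le_max lexx orbT.
  by apply: TP Fu Fv; rewrite le_max lexx.
have e2 : gp r (g s2) (g s1) <= C + D + A + D + A.
  by apply: (TP2 t v _ _ Fv); [rewrite !le_max lexx !orbT|rewrite gpC].
have main p q : domain a b p -> domain a b q -> p <= q ->
    gp r (g p) (g q) <= C + D + A + D + A ->
    exists2 s, domain a b s & mdist r (g s) <= C + 2 * D + 3 * A.
  move=> [ap pb] [aq qb] pq gpq.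
  have sub t' : 0 <= t' <= q - p -> domain a b (p + t').
    move=> /andP[t0 tl]; split; first by apply: le_trans ap _; rewrite lee_fin; lra.
    by apply: le_trans qb; rewrite lee_fin; lra.
  have seg : geodesic_segment (q - p) (fun t' => g (p + t')) (g p) (g q).
    split; rewrite ?subr_ge0 ?addr0 ?subrKC//.
    move=> x y; rewrite /= !in_itv/= => xI yI; rewrite geo; [|exact: sub..].
    by congr (`| _ |); ring.
  have [t' t'I h] := near r seg; exists (p + t'); first exact: sub.
  by apply: le_trans h _; lra.
have [le|lt] := leP s1 s2; first by apply: main s1I s2I le _; rewrite gpC.
exact: main s2I s1I (ltW lt) e2.
Qed.

End GeodesicBetween.

(** * Passing up *)

Lemma card_le_seq (T : eqType) (B : set T) n : (`I_n #<= B)%card ->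
  exists s : seq T, [/\ uniq s, size s = n & forall x, x \in s -> B x].
Proof.
move=> /card_leP[f].
have fI (i : 'I_n) : (i : nat) \in `I_n by rewrite inE /=.
pose g (i : 'I_n) : T := val (f (SigSub (fI i))).
exists [seq g i | i <- enum 'I_n]; split.
- rewrite map_inj_uniq ?enum_uniq// => i j /val_inj gij; apply/val_inj.
  have := @inj _ _ _ f (SigSub (fI i)) (SigSub (fI j)).
  by rewrite !inE => /(_ Logic.I Logic.I gij) /(congr1 val).
- by rewrite size_map size_enum_ord.
move=> _ /mapP[i _ ->]; apply: set_valP.
Qed.

Lemma card_le_inj (T : choiceType) (B : set T) n (f : nat -> T) :
  (forall i, (i < n)%N -> B (f i)) ->
  (forall i j, (i < n)%N -> (j < n)%N -> f i = f j -> i = j) ->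
  (`I_n #<= B)%card.
Proof.
move=> fB finj; have injf : {in `I_n &, injective f}.
  by move=> i j; rewrite !inE; apply: finj.
have <- := card_le_eql (inj_card_eq injf).
by apply: subset_card_le => _ [i iN <-]; apply: fB.
Qed.

Lemma eventually_all (R : realType) (T : eqType) (Q : T -> R -> Prop) (s : seq T) :
  (forall x, x \in s -> exists t0, forall t, t0 <= t -> Q x t) ->
  exists t0, forall t x, t0 <= t -> x \in s -> Q x t.
Proof.
elim: s => [|y s IHs] sQ; first by exists 0.
have [t0 t0P] := sQ y (mem_head _ _).
have [|t1 t1P] := IHs; first by move=> x xs; apply: sQ; rewrite in_cons xs orbT.
exists (Num.max t0 t1) => t x; rewrite ge_max => /andP[h0 h1].
by rewrite in_cons => /orP[/eqP->|xs]; [apply: t0P|apply: t1P].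
Qed.

Lemma strong_passing_up (R : realType) (d : Order.disp_t) (X : metricType R)
  (Dom : porderType d) (H : hhs_data X Dom) (c : hhs_constants R) (L N : R) :
  is_hhs H c -> 1 <= L -> 0 <= N ->
  exists E0 : R, forall E : R, E0 <= E ->
  forall (K1 K2 sigma : R) (n : nat), 50 * E <= K1 ->
  exists P : nat, (0 < P)%N /\
    forall (tau : (R -> X) -> Dom -> R), time_choice H L tau ->
    forall x y : X + (R -> X), in_ext H L x -> in_ext H L y ->
    forall Vs : set Dom, Vs `<=` Rel H c E N tau K1 x y ->
    (`I_P.+1 #<= Vs)%card ->
    exists (W : Dom) (Vs' : set Dom),
      passes_up H c E N tau K2 x y Vs W Vs' /\
      forall (a b : \bar R) (gamma : R -> C H W),
        geodesic_between a b gamma (ext_proj H c E N tau x W)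
                                   (ext_proj H c E N tau y W) ->
      forall p : C H W -> R,
        closest_point_projection (domain a b) gamma p ->
      forall (J : set int) (xs : int -> R),
        subdivision sigma (domain a b) J xs ->
        (`I_n #<= [set i | J i /\ piece_domains H Vs' p xs i !=set0])%card.
Proof.
move=> HH L1 N0.
have [A AP] := coarse_hhs_of_hhs HH.
have {AP} HA : coarse_hhs H A := AP A (lexx A); have A1 := chhs_ge1 HA.
have hyp := hhs_hyperbolicP HH.
have [M Mtop] := chhs_top HA; have [dl0 _ _] := hyp M.
have [D0 [AD approx]] := ray_proj_approx HA hyp L1 (lexx (L + 2 * A)).
have D00 : 0 <= D0 by lra.
(* The first three terms are the threshold in [ray_proj_approx]. With [D0] added, [50 * E <= K1]
   leaves [10 * A] after the loss [1 + 2 * D0] in [approximates_far]. *)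
exists (3 * A + 1 + 30 * c_delta c + D0) => E EE K1 K2 sigma n EK1.
pose C1 := 3 * A + 2 * D0 + 3 * A.
(* Large enough to exceed [K2] by the loss in [approximates_dist], and [sigma] by twice the distance
   [C1] from the chosen points to a geodesic. *)
pose sep := `|K2| + `|sigma| + 2 * C1 + 2 * (3 * A + 2 * D0 + A).
have K2n := ler_norm K2; have sn := ler_norm sigma.
have K20 := normr_ge0 K2; have s0 := normr_ge0 sigma.
have sep0 : 0 <= sep by rewrite /sep /C1; lra.
(* [n] domains fill different pieces; two are needed even for [n = 0], to force the diameter and the
   distance in [W] above [K2]. *)
have [P PP] := passing_up HA n.+2 sep0.
exists P.+1; split=> // tau htau x y hx hy Vs VsR VsP.
pose app (z : X + (R -> X)) t := match z with inl z => z | inr h => h t end.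
have ext_approx z U : in_ext H L z -> approximates D0 (ext_proj H c E N tau z U)
    (fun t => proj H U (app z t)).
  case: z => [z _|h hh] /=; last by apply: approx => //; lra.
  split; first exact: chhs_proj_neq0 HA _ _.
  by move=> q zq; exists 0 => t v _ zv; have := chhs_proj_diam HA zq zv; lra.
have ne z U t : proj H U (app z t) !=set0 by exact: chhs_proj_neq0 HA _ _.
have [Vl [uVl sVl VlVs]] := card_le_seq VsP.
have [T TP] : exists T : R, forall t V, T <= t -> V \in Vl ->
    far_apart H (10 * A) V (app x t) (app y t).
  apply: eventually_all => V /VlVs /VsR VR.
  have [T TP] := approximates_far (chhs_four_point HA (W := V)) D00 (ne x V) (ne y V)
    (ext_approx x V hx) (ext_approx y V hy) VR.
  by exists T => t Tt u v xu yv; have := TP t u v Tt xu yv; lra.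
have [|W [Us [uUs sUs Usn UsW Ussep]]] :=
    PP (app x T) (app y T) Vl uVl _ (fun V => TP T V (lexx T)).
  by rewrite sVl.
have gp_le V r : V \in Us -> rho H V W r -> forall t u v, T <= t ->
    proj H W (app x t) u -> proj H W (app y t) v -> gromov_product r u v <= 3 * A.
  move=> VU rr t u v Tt xu yv; apply: (gp_rho_far HA (UsW V VU) _ xu yv rr).
  move=> p q xp yq; have := TP t V Tt (sUs V VU) p q xp yq; lra.
have Ui i : (i < n.+2)%N -> nth M Us i \in Us by move=> iN; rewrite mem_nth ?Usn.
have [p0 _] := chhs_rho_neq0 HA (or_introl (UsW _ (Ui 0%N isT))).
have /choice[pt ptP] (i : nat) : exists r, (i < n.+2)%N -> rho H (nth M Us i) W r.
  have [iN|] := ltnP i n.+2; last by exists p0.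
  by have [r rr] := chhs_rho_neq0 HA (or_introl (UsW _ (Ui i iN))); exists r.
have pt_far i j : (i < n.+2)%N -> (j < n.+2)%N -> i <> j -> sep < mdist (pt i) (pt j).
  move=> iN jN ij; apply: Ussep (Ui i iN) (Ui j jN) _ (ptP i iN) (ptP j jN).
  by move=> /eqP; rewrite nth_uniq ?Usn// => /eqP.
have far01 := pt_far 0%N 1%N isT isT (ltac:(by [])).
exists W, [set` Us]; split.
  split=> //.
  - apply: (approximates_dist (chhs_four_point HA (W := W)) (chhs_geodesic HA (W := W))
      (chhs_near HA (W := W)) (ne x W) (ne y W) (ext_approx x W hx) (ext_approx y W hy)
      (C := 3 * A) (r := pt 0%N) (r' := pt 1%N)); last by rewrite /sep /C1 in far01; lra.
    exists T => t u v Tt xu yv.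
    by split; [exact: (gp_le _ _ (Ui 0%N isT) (ptP 0%N isT) t u v Tt xu yv)|
      exact: (gp_le _ _ (Ui 1%N isT) (ptP 1%N isT) t u v Tt xu yv)].
  - by move=> V /sUs /VlVs.
  apply: (lt_diam (x := pt 0%N) (y := pt 1%N)).
  - by exists (nth M Us 0); [exact: Ui|exact: ptP].
  - by exists (nth M Us 1); [exact: Ui|exact: ptP].
  by rewrite /sep /C1 in far01; lra.
move=> a b gamma gab p pP J xs [_ Icover step _].
have near_p i : (i < n.+2)%N -> mdist (pt i) (gamma (p (pt i))) <= C1.
  move=> iN; have A0 : 0 <= A by lra.
  have [|s sI h] := near_geodesic_between (chhs_four_point HA (W := W)) A0 D00
    (chhs_near HA (W := W)) (r := pt i) (C := 3 * A) (ne x W) (ne y W)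
    (ext_approx x W hx) (ext_approx y W hy) gab.
    by exists T => t u v Tt xu yv; exact: (gp_le _ _ (Ui i iN) (ptP i iN) t u v Tt xu yv).
  by apply: le_trans ((pP (pt i)).2 s sI) h.
have /choice[pc pcP] (i : nat) : exists j : int, J j /\ xs j <= p (pt i) <= xs (j + 1).
  have [] := pP (pt i); rewrite {1}Icover => -[j Jj] /= + _.
  by rewrite in_itv/= => pj; exists j.
apply: (card_le_inj (f := pc)) => [i iN|i j iN jN].
  have [Jj pj] := pcP i; have iN2 := leq_trans iN (leq_addl 2 n).
  split=> //; exists (nth M Us i); split; first exact: Ui.
  exists (p (pt i)); split; last by rewrite /= in_itv.
  by exists (pt i) => //; apply: ptP.
(* Two of the points projecting to the same piece would be at distance at most [|sigma| + 2 * C1],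
   hence at most [sep]. *)
move=> pcij; apply: contrapT => ij.
have iN2 := leq_trans iN (leq_addl 2 n); have jN2 := leq_trans jN (leq_addl 2 n).
have far := pt_far i j iN2 jN2 ij.
have [Ji /andP[i1 i2]] := pcP i; have [_ /andP[j1 j2]] := pcP j.
have /andP[_ st] := step _ Ji; rewrite -pcij in j1 j2.
have pij : mdist (gamma (p (pt i))) (gamma (p (pt j))) <= `|sigma|.
  have [_ geo _ _] := gab; rewrite geo; [|exact: (pP _).1..].
  by rewrite ler_norml; apply/andP; split; lra.
have := near_p i iN2; have := near_p j jN2.
have := metric_triangle (pt i) (gamma (p (pt i))) (pt j).
have := metric_triangle (gamma (p (pt i))) (gamma (p (pt j))) (pt j).
rewrite (metric_sym (gamma (p (pt j))) (pt j)).
by rewrite /sep /C1 in far *; lra.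
Qed.

Theorem proposition4p7 (R : realType) (d : Order.disp_t) (X : metricType R)
  (Dom : porderType d) (H : hhs_data X Dom) (c : hhs_constants R) (L N : R) :
  is_hhs H c ->
  hierarchy_constant H L ->
  (forall W : Dom, morse_constant (C H W) 1 (20 * c_delta c) N) ->
  exists E0 : R, forall E : R, E0 <= E ->
  forall K1 K2 : R, 50 * E <= K1 -> K1 <= K2 ->
  (exists P1 : nat, (0 < P1)%N /\
     forall (tau : (R -> X) -> Dom -> R), time_choice H L tau ->
     forall x y : X + (R -> X), in_ext H L x -> in_ext H L y ->
     forall Vs : set Dom, Vs `<=` Rel H c E N tau K1 x y ->
     (`I_P1.+1 #<= Vs)%card ->
     exists (W : Dom) (Vs' : set Dom),
       passes_up H c E N tau K2 x y Vs W Vs') /\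
  (forall (sigma : R) (n : nat), 10 * E <= sigma ->
   exists P2 : nat, (0 < P2)%N /\
     forall (tau : (R -> X) -> Dom -> R), time_choice H L tau ->
     forall x y : X + (R -> X), in_ext H L x -> in_ext H L y ->
     forall Vs : set Dom, Vs `<=` Rel H c E N tau K1 x y ->
     (`I_P2.+1 #<= Vs)%card ->
     exists (W : Dom) (Vs' : set Dom),
       passes_up H c E N tau K2 x y Vs W Vs' /\
       forall (a b : \bar R) (gamma : R -> C H W),
         geodesic_between a b gamma (ext_proj H c E N tau x W)
                                    (ext_proj H c E N tau y W) ->
       forall p : C H W -> R,
         closest_point_projection (domain a b) gamma p ->
       forall (J : set int) (xs : int -> R),
         subdivision sigma (domain a b) J xs ->
         (`I_n #<= [set i | J i /\ piece_domains H Vs' p xs i !=set0])%card).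
Proof.
move=> HH [L1 _] morseN.
have [M _] := hhs_top HH; have [N0 _] := morseN M.
have [E0 main] := strong_passing_up HH L1 N0.
exists E0 => E EE K1 K2 EK1 K12; split; last first.
  by move=> sigma n _; apply: main.
(* For [n = 0] the clause on subdivisions is void. *)
have [P [P0 PP]] := main E EE K1 K2 0 0%N EK1.
exists P; split=> // tau htau x y hx hy Vs VsR VsP.
by have [W [Vs' [h _]]] := PP tau htau x y hx hy Vs VsR VsP; exists W, Vs'.
Qed.
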